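(* Let $\Delta$ be a pure simplicial complex of dimension $d-1$ on the vertex set $[n]$ such that (i) $\Delta$ is contractible; (ii) $\Delta$ does not have a free face; (iii) the clique complex of $\mathcal{C}_{\Delta}$ is of dimension $d-1$, where $\mathcal{C}_\Delta$ is the $d$-uniform clutter on $[n]$ whose circuits are the facets of $\Delta$. Then (a) $\mathcal{C}_{\Delta}$ is not a chordal clutter. (b) The ideal $I(\bar{\mathcal{C}}_\Delta)$ has a linear resolution over all fields.
   Context: $[n]=\{1,\ldots,n\}$. A simplicial complex is pure if all its facets (maximal faces) have the same dimension, where $\dim F=|F|-1$; it is contractible if its geometric realization is a contractible topological space. A face of a simplicial complex is a free face if it is properly contained in a unique facet. A $d$-uniform clutter $\mathcal{C}$ on $[n]$ is a collection of $d$-element subsets (circuits) of $[n]$; $\bar{\mathcal{C}}$ is the collection of all $d$-subsets of $[n]$ not in $\mathcal{C}$. For $T\subseteq[n]$, $\mathbf{x}_T=\prod_{i\in T}x_i$; $I(\mathcal{C})=(\mathbf{x}_T : T\in\mathcal{C})\subset S=\mathbb{K}[x_1,\ldots,x_n]$. The clique complex $\Delta(\mathcal{C})$ is the simplicial complex of all $G\subseteq[n]$ such that $|G|<d$ or all $d$-subsets of $G$ belong to $\mathcal{C}$. For a $(d-1)$-subset $e$ of $[n]$, $N_{\mathcal{C}}[e]=e\cup\{c\in[n] : e\cup\{c\}\in\mathcal{C}\}$; $e$ is a simplicial maximal subcircuit of $\mathcal{C}$ if $e\subset F$ for some $F\in\mathcal{C}$ and $N_{\mathcal{C}}[e]\in\Delta(\mathcal{C})$.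 The deletion is $\mathcal{C}\setminus e=\{F\in\mathcal{C} : e\nsubseteq F\}$. A $d$-uniform clutter $\mathcal{C}$ is chordal if (recursively) either $\mathcal{C}=\varnothing$, or $\mathcal{C}$ admits a simplicial maximal subcircuit $e$ such that $\mathcal{C}\setminus e$ is chordal. A nonzero homogeneous ideal $I\subset S$ generated in degree $d$ has a linear resolution if $\beta_{i,j}(I)=\dim_{\mathbb{K}}\mathrm{Tor}^S_i(\mathbb{K},I)_j=0$ for all $i,j$ with $j-i>d$; ''over all fields'' means this holds for every field $\mathbb{K}$. *)

(* Defs.v *)
From HB Require Import structures.
From mathcomp Require Import all_boot all_order all_algebra.
From mathcomp Require mpoly all_classical all_reals all_analysis.
Set Implicit Arguments.
Unset Strict Implicit.
Unset Printing Implicit Defensive.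

(* The vertex set [n] = {1, ..., n} is rendered as 'I_n = {0, ..., n-1}. *)

Section Complexes.
Variable n : nat.
Implicit Types (D C : {set {set 'I_n}}) (F e : {set 'I_n}) (d : nat).

(* "on the vertex set [n]": every point of [n] is a vertex *)
Definition simplicial_complex_on D : Prop :=
  (forall v : 'I_n, [set v] \in D) /\
  (forall F G : {set 'I_n}, F \in D -> G \subset F -> G \in D).

Definition facets D : {set {set 'I_n}} :=
  [set F in D | [forall G in D, (F \subset G) ==> (F == G)]].

Definition face_dim F : int := (#|F|%:Z - 1)%R.

(* The maximum of #|F| - 1 over the faces; the void complex gets -1. *)
Definition complex_dim D : int := ((\max_(F in D) #|F|)%:Z - 1)%R.

Definition pure D : Prop :=
  {in facets D &, forall F G, face_dim F = face_dim G}.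

(* The empty face is allowed to be free. *)
Definition free_face D F : Prop :=
  F \in D /\ exists! G, G \in facets D /\ F \proper G.

Definition clutter_compl d C : {set {set 'I_n}} :=
  [set F : {set 'I_n} | (#|F| == d) && (F \notin C)].

Definition clique_complex d C : {set {set 'I_n}} :=
  [set G : {set 'I_n} | (#|G| < d) ||
     [forall F : {set 'I_n}, (F \subset G) && (#|F| == d) ==> (F \in C)]].

Definition closed_nbhd C e : {set 'I_n} := e :|: [set c | c |: e \in C].

Definition simplicial_subcircuit d C e : Prop :=
  [/\ #|e|.+1 = d,
      exists2 F, F \in C & e \subset F
    & closed_nbhd C e \in clique_complex d C].

Definition deletion C e : {set {set 'I_n}} := [set F in C | ~~ (e \subset F)].

Inductive chordal d : {set {set 'I_n}} -> Prop :=
| chordal_empty : chordal d set0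
| chordal_deletion C e :
    simplicial_subcircuit d C e -> chordal d (deletion C e) -> chordal d C.

End Complexes.

(* multinomials and mathcomp-analysis have incompatible notations, hence the
   two separate modules. *)
Module Resolutions.
Import mpoly.
Import GRing.Theory.
Local Open Scope ring_scope.

Section Resolutions.
Variables (K : fieldType) (n : nat).
Local Notation S := {mpoly K[n]}.

Definition ideal_gen (s : seq S) (p : S) : Prop :=
  exists c : 'I_(size s) -> S, p = \sum_(i < size s) c i * s`_i.

Definition circuit_monomial (T : {set 'I_n}) : S := \prod_(i in T) 'X_i.

Definition circuit_ideal (C : {set {set 'I_n}}) : S -> Prop :=
  ideal_gen [seq circuit_monomial T | T <- enum C].

(* v belongs to the degree j part of the graded free module
   S(-a_0) (+) ... (+) S(-a_(r-1)), whose elements are row vectors. *)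
Definition homog_vec r (a : 'I_r -> nat) (j : nat) (v : 'rV[S]_r) : Prop :=
  forall k (m : 'X_{1..n}), (v 0 k)@_m != 0 -> (mdeg m + a k)%N = j.

(* A graded free resolution
     ... -> P_2 -> P_1 -> P_0 -> K -> 0
   of K = S/(x_1, ..., x_n), with P_i = (+)_k S(- res_shift i k).  Maps act on
   row vectors by right multiplication, and the augmentation P_0 -> K sends v
   to sum_k v_k(0) * res_aug_k. *)
Record residue_resolution := ResidueResolution {
  res_rank : nat -> nat;
  res_shift : forall i, 'I_(res_rank i) -> nat;
  res_diff : forall i, 'M[S]_(res_rank i.+1, res_rank i);
  res_aug : 'cV[K]_(res_rank 0);
  res_diff_graded : forall i k,
    homog_vec (@res_shift i) (@res_shift i.+1 k) (row k (res_diff i));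
  res_aug_graded : forall k, res_aug k 0 != 0 -> @res_shift 0 k = 0%N;
  res_aug_surj : exists v : 'rV[S]_(res_rank 0),
    map_mx (mcoeff 0%MM) v *m res_aug = 1%:M;
  res_exact0 : forall v : 'rV[S]_(res_rank 0),
    map_mx (mcoeff 0%MM) v *m res_aug = 0 <-> exists w, v = w *m res_diff 0;
  res_exactS : forall i (v : 'rV[S]_(res_rank i.+1)),
    v *m res_diff i = 0 <-> exists w, v = w *m res_diff i.+1
}.

Section Tor.
Variables (I : S -> Prop) (P : residue_resolution).

(* Since P_i is free, P_i (x)_S I is the submodule of P_i of the vectors with
   all entries in I, and the differential of P (x)_S I is that of P. *)
Definition tor_chain (i j : nat) (v : 'rV[S]_(res_rank P i)) : Prop :=
  homog_vec (@res_shift P i) j v /\ (forall k, I (v 0 k)).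

Definition tor_cycle (i j : nat) : 'rV[S]_(res_rank P i) -> Prop :=
  match i with
  | 0 => fun v => tor_chain j v
  | i'.+1 => fun v => tor_chain j v /\ v *m res_diff P i' = 0
  end.

Definition tor_boundary (i j : nat) (v : 'rV[S]_(res_rank P i)) : Prop :=
  exists2 w : 'rV[S]_(res_rank P i.+1), tor_chain j w & v = w *m res_diff P i.

End Tor.

(* V/W has K-dimension b: there are b vectors of V whose classes form a basis *)
Definition subquotient_dim r (V W : 'rV[S]_r -> Prop) (b : nat) : Prop :=
  exists z : 'I_b -> 'rV[S]_r,
    [/\ forall k, V (z k),
        forall c : 'I_b -> K,
          W (\sum_k (c k)%:MP *: z k) -> forall k, c k = 0
      & forall v, V v -> exists c : 'I_b -> K,
          W (v - \sum_k (c k)%:MP *: z k)].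

(* beta_{i,j}(I) = b, that is dim_K Tor_i(K, I)_j = b; Tor may be computed
   from any graded free resolution of K, and does not depend on it. *)
Definition graded_betti (I : S -> Prop) (i j b : nat) : Prop :=
  exists P : residue_resolution,
    subquotient_dim (@tor_cycle I P i j) (@tor_boundary I P i j) b.

Definition generated_in_degree (d : nat) (I : S -> Prop) : Prop :=
  exists2 s : seq S, {in s, forall g, g \is d.-homog}
    & forall p, I p <-> ideal_gen s p.

Definition linear_resolution (d : nat) (I : S -> Prop) : Prop :=
  [/\ exists2 p, I p & p != 0,
      generated_in_degree d I
    & forall i j, (i + d < j)%N -> graded_betti I i j 0].

End Resolutions.

Arguments circuit_ideal K {n} C p.

End Resolutions.

Notation circuit_ideal := Resolutions.circuit_ideal.
Notation linear_resolution := Resolutions.linear_resolution.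

Module Topology.
Import all_classical all_reals all_analysis.
Import Order.TTheory GRing.Theory Num.Theory numFieldNormedType.Exports.
Local Open Scope classical_set_scope.
Local Open Scope ring_scope.

(* Barycentric coordinates: the points of the standard simplex of R^n whose
   support is a face, with the topology induced by R^n. *)
Definition realization (R : realType) n (D : {set {set 'I_n}}) :
    set 'rV[R]_n :=
  [set x : 'rV[R]_n |
    [/\ forall i, 0 <= x 0 i, \sum_i x 0 i = 1
      & [set i | x 0 i != 0]%SET \in D]].

Arguments realization R {n} D x.

(* The subspace A is nonempty and its identity map is null-homotopic. *)
Definition contractible (R : realType) (T : topologicalType) (A : set T) :
    Prop :=
  exists2 p, A p & exists H : T * R -> T,
    [/\ {within A `*` `[0, 1], continuous H},
        forall (x : T) (t : R), A x -> 0 <= t <= 1 -> A (H (x, t)),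
        forall x, A x -> H (x, 0) = x
      & forall x, A x -> H (x, 1) = p].

Definition contractible_complex (R : realType) n (D : {set {set 'I_n}}) : Prop :=
  contractible R (realization R D).

End Topology.

Notation contractible_complex := Topology.contractible_complex.

(* Main.v *)
(* (a) If e is a simplicial maximal subcircuit, its closed neighbourhood is a
   clique with at most d vertices, hence the only facet containing e, so that
   e is a free face.

   (b) Tor is computed with the Koszul complex, one squarefree multidegree W
   at a time.  There, complementation in W turns the obstruction to bounding a
   cycle inside the ideal into a (d-1)-cochain on the facets contained in W,
   which must be a coboundary; by linear duality this holds as soon as the
   complex carries no nonzero (d-1)-cycle.

   Singular homology and subdivisions are avoided as follows.  A chain is a
   linear functional on functions of finite sequences of points.  Cutting a
   homotopy to a constant into short time steps and adding up the prisms shows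
   that, in a contractible compact set, a cycle made of small enough tuples of
   points bounds a chain of still small tuples.  Applied to straight-line
   homotopies in single faces, this replaces each face by a chain of small
   tuples with the right boundary; applied to the given contraction, it bounds
   the image of a (d-1)-cycle by a chain of small (d+1)-tuples.  Sending each point
   to a vertex with largest barycentric coordinate maps small tuples back to
   faces, where (d+1)-tuples are degenerate; a determinantal form of Sperner's
   lemma says that this round trip is the identity on the top faces. *)

Require Import Defs.
From mathcomp Require Import all_boot all_order all_algebra reals.
From mathcomp Require Import ring lra zify.
From mathcomp Require mpoly boolp all_classical all_reals all_analysis.

Set Implicit Arguments.
Unset Strict Implicit.
Unset Printing Implicit Defensive.

(** * Cochains on finite sequences and simplicial boundaries *)
Module Simplicial.
Import GRing.Theory.
Local Open Scope ring_scope.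

Section Cochains.
Variable K : fieldType.

(** The value of [phi] on the augmented boundary of the tuple [s]: the boundary of a one-point tuple
    is the empty tuple, whose own boundary is 0. The recursion on the first entry lets every
    identity be proved by induction on [s]; [cob_sum] is the closed form. *)
Fixpoint cob (T : Type) (phi : seq T -> K) (s : seq T) : K :=
  if s is x :: s' then phi s' - cob (phi \o cons x) s' else 0.

(** The classical prism operator between [f] and [g]: it evaluates [phi] on the tuples (f x_0, ...,
    f x_i, g x_i, ..., g x_k) with sign (-1)^i. *)
Fixpoint prism (S T : Type) (f g : S -> T) (phi : seq T -> K) (s : seq S) : K :=
  if s is x :: s' then
    phi (f x :: map g s) - prism f g (phi \o cons (f x)) s'
  else 0.

Lemma cob_linear (T : Type) a (phi psi : seq T -> K) s :
  cob (fun t => a * phi t + psi t) s = a * cob phi s + cob psi s.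
Proof.
elim: s phi psi => [|x s IH] phi psi /=; first by rewrite mulr0 addr0.
by rewrite (IH (phi \o cons x)); ring.
Qed.

Lemma cobB (T : Type) (phi psi : seq T -> K) s :
  cob (fun t => phi t - psi t) s = cob phi s - cob psi s.
Proof.
elim: s phi psi => [|x s IH] phi psi /=; first by rewrite subrr.
by rewrite (IH (phi \o cons x)); ring.
Qed.

Lemma eq_cob (T : Type) (phi psi : seq T -> K) s :
  phi =1 psi -> cob phi s = cob psi s.
Proof.
elim: s phi psi => [//|x s IH] phi psi e /=.
by rewrite e (IH _ (psi \o cons x)) // => t /=; apply: e.
Qed.

Lemma eq_cob_in (T : eqType) (phi psi : seq T -> K) s :
  (forall t, size s = (size t).+1 -> {subset t <= s} -> phi t = psi t) ->
  cob phi s = cob psi s.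
Proof.
elim: s phi psi => [//|x s IH] phi psi e /=; congr (_ - _).
  by apply: e => // y ys; rewrite inE ys orbT.
apply: IH => t st ts; apply: e => /=; first by rewrite st.
by move=> y; rewrite !inE => /orP[->//|/ts ->]; rewrite orbT.
Qed.

Lemma cob_map (S T : Type) (f : S -> T) (phi : seq T -> K) s :
  cob (phi \o map f) s = cob phi (map f s).
Proof. by elim: s phi => [//|x s IH] phi /=; rewrite -IH. Qed.

Lemma cob_cob (T : Type) (phi : seq T -> K) s : cob (cob phi) s = 0.
Proof.
elim: s phi => [//|x s IH] phi /=.
rewrite (@eq_cob _ (cob phi \o cons x) (fun t => phi t - cob (phi \o cons x) t)) //.
by rewrite (cobB phi) IH; ring.
Qed.

Lemma prismB (S T : Type) (f g : S -> T) (phi psi : seq T -> K) s :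
  prism f g (fun t => phi t - psi t) s = prism f g phi s - prism f g psi s.
Proof.
elim: s phi psi => [|x s IH] phi psi /=; first by rewrite subrr.
by rewrite (IH (phi \o cons (f x))); ring.
Qed.

Lemma prism_linear (S T : Type) (f g : S -> T) a (phi psi : seq T -> K) s :
  prism f g (fun t => a * phi t + psi t) s =
  a * prism f g phi s + prism f g psi s.
Proof.
elim: s phi psi => [|x s IH] phi psi /=; first by rewrite mulr0 addr0.
by rewrite (IH (phi \o cons (f x))); ring.
Qed.

Lemma eq_prism_in (S T : eqType) (f g : S -> T) (phi psi : seq T -> K) s :
  (forall t, size t = (size s).+1 ->
    {in t, forall y, exists2 x, x \in s & y = f x \/ y = g x} ->
    phi t = psi t) ->
  prism f g phi s = prism f g psi s.
Proof.
elim: s phi psi => [//|x s IH] phi psi e /=; congr (_ - _).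
  apply: e => /=; first by rewrite size_map.
  move=> y; rewrite !inE => /or3P[/eqP->|/eqP->|/mapP[z zs ->]].
  - by exists x; rewrite ?mem_head //; left.
  - by exists x; rewrite ?mem_head //; right.
  - by exists z; rewrite ?inE ?zs ?orbT //; right.
apply: IH => t st ts; apply: e => /=; first by rewrite st.
move=> y; rewrite inE => /orP[/eqP->|/ts[z zs yz]].
  by exists x; rewrite ?mem_head //; left.
by exists z; rewrite ?inE ?zs ?orbT.
Qed.

Lemma prism_cob (S T : Type) (f g : S -> T) (phi : seq T -> K) s :
  prism f g (cob phi) s + cob (prism f g phi) s =
  phi (map g s) - phi (map f s).
Proof.
elim: s phi => [|x s IH] phi /=; first by rewrite subrr addr0.
have -> : prism f g (cob phi \o cons (f x)) s =
    prism f g phi s - prism f g (cob (phi \o cons (f x))) s.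
  by rewrite -prismB.
have -> : cob (prism f g phi \o cons x) s =
    cob ((phi \o cons (f x) \o cons (g x)) \o map g) s
    - cob (prism f g (phi \o cons (f x))) s.
  by rewrite -cobB.
rewrite cob_map /=.
have /= := IH (phi \o cons (f x)).
move/(canRL (addrK _)) => ->.
by ring.
Qed.

Lemma cob_nseq (T : Type) (phi : seq T -> K) k (p : T) :
  cob phi (nseq k p) = if odd k then phi (nseq k.-1 p) else 0.
Proof.
elim: k phi => [//|k IH] phi /=; rewrite IH.
by case: k {IH} => [|k] /=; [rewrite subr0|case: (odd k); rewrite /= ?subr0 ?subrr].
Qed.

Lemma cob_const1 (T : Type) (s : seq T) : cob (fun=> 1) s = (odd (size s))%:R.
Proof.
elim: s => [//|x s IH] /=; rewrite (@eq_cob _ ((fun=> 1) \o cons x) (fun=> 1)) // IH.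
by case: (odd _); rewrite /= ?subr0 ?subrr.
Qed.

(* A chain is encoded as a linear functional on cochains; it is carried by Q
   when its value only depends on the restriction of the cochain to Q. *)
Definition chain (T : Type) (Q : seq T -> Prop) (L : (seq T -> K) -> K) : Prop :=
  (forall a phi psi, L (fun t => a * phi t + psi t) = a * L phi + L psi) /\
  (forall phi psi, (forall t, Q t -> phi t = psi t) -> L phi = L psi).

(** A stand-in for small singular simplices: only the vertices are recorded, and [E] expresses that
    they are pairwise close, in both orders and for equal entries as well. *)
Definition small (T : eqType) (X : T -> Prop) (E : T -> T -> Prop) (m : nat)
    (s : seq T) : Prop :=
  [/\ size s = m, {in s, forall x, X x} & {in s &, forall x y, E x y}].

Section Chain.
Variables (T : Type) (Q : seq T -> Prop) (L : (seq T -> K) -> K).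
Hypothesis cL : chain Q L.

Lemma chainB phi psi : L (fun t => phi t - psi t) = L phi - L psi.
Proof.
have -> : L (fun t => phi t - psi t) = L (fun t => (-1) * psi t + phi t).
  by apply: cL.2 => t _; ring.
by rewrite cL.1; ring.
Qed.

Lemma chain0 phi : (forall t, Q t -> phi t = 0) -> L phi = 0.
Proof.
move=> e; rewrite (cL.2 _ (fun t => phi t - phi t)); first by rewrite chainB subrr.
by move=> t /e->; rewrite subrr.
Qed.

Lemma chainD phi psi : L (fun t => phi t + psi t) = L phi + L psi.
Proof.
have -> : L (fun t => phi t + psi t) = L (fun t => 1 * phi t + psi t).
  by apply: cL.2 => t _; ring.
by rewrite cL.1 mul1r.
Qed.

Lemma chain_scale a phi : L (fun t => a * phi t) = a * L phi.
Proof.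
have -> : L (fun t => a * phi t) = L (fun t => a * phi t + 0).
  by apply: cL.2 => t _; ring.
by rewrite cL.1 (@chain0 (fun=> 0)) ?addr0.
Qed.

End Chain.

Lemma chain_sub (T : Type) (Q Q' : seq T -> Prop) (L : (seq T -> K) -> K) :
  (forall s, Q s -> Q' s) -> chain Q L -> chain Q' L.
Proof.
by move=> QQ' [lin loc]; split=> // phi psi e; apply: loc => t /QQ'; exact: e.
Qed.

(** Here [h] is a contraction to [p] sampled at times 0 to [N]. Each prism between times i and i+1
    only mixes points at equal or consecutive times, which the two hypotheses on [E'] keep close;
    the sum of these prisms bounds the difference of [Z] and its image under [h N]. *)
Lemma homotopic_cycle_bounds (T : eqType) (X : T -> Prop) (E E' : T -> T -> Prop)
    (N : nat) (h : nat -> T -> T) (p : T) (m : nat) (Z : (seq T -> K) -> K) :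
  (forall i x, (i <= N)%N -> X x -> X (h i x)) ->
  (forall x, X x -> h 0 x = x) -> (forall x, X x -> h N x = p) ->
  (forall i x y, (i <= N)%N -> X x -> X y -> E x y -> E' (h i x) (h i y)) ->
  (forall i x y, (i < N)%N -> X x -> X y -> E x y ->
     E' (h i x) (h i.+1 y) /\ E' (h i.+1 y) (h i x)) ->
  X p -> E' p p ->
  chain (small X E m) Z -> (forall phi, Z (cob phi) = 0) ->
  exists2 W, chain (small X E' m.+1) W & forall phi, Z phi = W (cob phi).
Proof.
move=> hX h0 hN hE hE' Xp Epp cZ dZ.
have homotopic i : (i <= N)%N -> exists2 W, chain (small X E' m.+1) W &
    forall phi, Z phi - Z (phi \o map (h i)) = W (cob phi).
  elim: i => [_|i IH iN].
    exists (fun=> 0); first by split=> *; rewrite ?mulr0 ?addr0.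
    move=> phi; apply/eqP; rewrite subr_eq0; apply/eqP; apply: cZ.2 => s [_ sX _] /=.
    by congr phi; rewrite -[LHS]map_id; apply/eq_in_map => x /sX /h0 ->.
  have [W cW dW] := IH (ltnW iN).
  exists (fun phi => W phi - Z (prism (h i) (h i.+1) phi)).
    split=> [a phi psi|phi psi e].
      rewrite cW.1 (cZ.2 _ (fun s => a * prism (h i) (h i.+1) phi s +
          prism (h i) (h i.+1) psi s)); last by move=> s _; rewrite prism_linear.
      by rewrite cZ.1; ring.
    congr (_ - _); first exact: cW.2.
    apply: cZ.2 => s [ss sX sE]; apply: eq_prism_in => t; rewrite ss => st ts.
    apply: e; split=> // [y /ts[x xs [] ->]|].
    - by apply: hX (ltnW iN) _; apply: sX.
    - by apply: hX iN _; apply: sX.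
    move=> y y' /ts[x xs yx] /ts[x' xs' yx'].
    have [Xx Xx'] := (sX _ xs, sX _ xs').
    have [Exx' Ex'x] := (sE _ _ xs xs', sE _ _ xs' xs).
    case: yx => ->; case: yx' => ->.
    - exact: hE (ltnW iN) _ _ _.
    - by have [] := hE' i x x' iN Xx Xx' Exx'.
    - by have [] := hE' i x' x iN Xx' Xx Ex'x.
    - exact: hE.
  move=> phi; rewrite -dW.
  have := chainB cZ (phi \o map (h i.+1)) (phi \o map (h i)).
  rewrite (cZ.2 _ (fun s => prism (h i) (h i.+1) (cob phi) s +
     cob (prism (h i) (h i.+1) phi) s)); last by move=> s _; rewrite prism_cob.
  rewrite (chainD cZ) dZ addr0 => ->; ring.
(* What remains is Z(1) times a constant tuple: for m even it is a boundary,
   for m odd Z(1) = 0 since the boundary of such a tuple is nonzero. *)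
have [W cW dW] := homotopic N (leqnn N).
have Zconst phi : Z (phi \o map (h N)) = Z (fun=> 1) * phi (nseq m p).
  rewrite mulrC -(chain_scale cZ); apply: cZ.2 => s [ss sX _] /=; rewrite mulr1.
  congr phi; rewrite -ss; elim: s sX {ss} => //= x s IH sX.
  rewrite hN ?IH //; last by apply: sX; rewrite mem_head.
  by move=> y ys; apply: sX; rewrite inE ys orbT.
case: (boolP (odd m)) => om.
  exists W => // phi; rewrite -dW Zconst.
  rewrite (cZ.2 (fun=> 1) (cob (fun=> 1))); first by rewrite dZ mul0r subr0.
  by move=> s [ss _ _]; rewrite cob_const1 ss om.
exists (fun phi => W phi + Z (fun=> 1) * phi (nseq m.+1 p)).
  split=> [a phi psi|phi psi e]; first by rewrite cW.1; ring.
  rewrite (cW.2 _ _ e) e //; split; first exact: size_nseq.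
  - by move=> x /nseqP[->].
  - by move=> x y /nseqP[-> _] /nseqP[-> _].
by move=> phi; rewrite -dW cob_nseq /= om Zconst; ring.
Qed.
End Cochains.

(** * Determinant cochains and Sperner's lemma *)

Section DetCochain.
Variables (K : fieldType) (T : eqType) (x0 : T).

(** For a duplicate-free [s], this is the alternating cochain dual to the oriented simplex [s]:
    among tuples of the same length it gives the sign on rearrangements of [s] and 0 elsewhere. *)
Definition detc (s u : seq T) : K :=
  \det (\matrix_(i < size s, j < size s) (nth x0 u i == nth x0 s j)%:R).

Lemma cob_sum (phi : seq T -> K) s :
  cob phi s = \sum_(i < size s) (-1) ^+ i * phi (take i s ++ drop i.+1 s).
Proof.
elim: s phi => [|x s IH] phi /=; first by rewrite big_ord0.
rewrite IH big_ord_recl expr0 mul1r /= drop0 -sumrN; congr (_ + _).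
by apply: eq_bigr => i _; rewrite /bump /= add1n exprS mulN1r mulNr.
Qed.

Lemma nth_del (u : seq T) k i :
  nth x0 (take i u ++ drop i.+1 u) k = nth x0 u (bump i k).
Proof.
elim: u i k => [|y u IH] [|i] [|k] //=; rewrite ?drop0 ?nth_nil //.
by rewrite IH /bump ltnS addnS.
Qed.

(** The incidence matrix of [u] against [s], bordered by a column of ones: cofactor expansion along
    that column is exactly the alternating sum in [cob]. *)
Definition det1_mx (s u : seq T) : 'M[K]_((size s).+1) :=
  \matrix_(i, j) if unlift ord0 j is Some j' then
    (nth x0 u i == nth x0 s j')%:R else 1.

Lemma cob_detc s u : size u = (size s).+1 -> cob (detc s) u = \det (det1_mx s u).
Proof.
move=> su; rewrite cob_sum su (expand_det_col _ ord0); apply: eq_bigr => i _.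
rewrite mxE unlift_none mul1r /cofactor addn0; congr (_ * \det _).
apply/matrixP => k l; rewrite !mxE liftK.
by rewrite nth_del.
Qed.

(** A repeated entry of [u] makes two rows of the bordered matrix equal. This is how degenerate
    tuples are discarded later. *)
Lemma cob_detc_nuniq s u : size u = (size s).+1 -> ~~ uniq u ->
  cob (detc s) u = 0.
Proof.
move=> su nu; rewrite cob_detc //.
have [i [j [ij js]]] : exists i j,
    [/\ (i < j)%N, (j < size u)%N & nth x0 u i = nth x0 u j].
  by move/(uniqPn x0): nu => [i [j [? ? ?]]]; exists i, j.
rewrite su in js => eij.
have i1 := ltn_trans ij js.
apply: (@determinant_alternate _ _ _ (Ordinal i1) (Ordinal js)).
  by rewrite -val_eqE /= ltn_eqF.
by move=> k; rewrite !mxE /= eij.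
Qed.

Lemma detc_cob x s u : uniq (x :: s) -> {subset u <= x :: s} ->
  size u = (size s).+1 -> detc (x :: s) u = cob (detc s) u.
Proof.
move=> us sub su; rewrite cob_detc // /detc /=.
set A := (X in \det X = _).
(* Multiplication by the unitriangular [L] adds all the columns to the first one. Each entry of [u]
   occurs exactly once in [x :: s], so every row of the incidence matrix sums to 1 and the first
   column becomes the column of ones. *)
pose L : 'M[K]_((size s).+1) := \matrix_(i, j) ((i == j) || (j == ord0))%:R.
have -> : det1_mx s u = A *m L.
  apply/matrixP => i j; rewrite !mxE.
  case: unliftP => [j' ->|->].
    rewrite (bigD1 (lift ord0 j')) //= !mxE eqxx mulr1 big1 ?addr0 //.
    by move=> k /negPf kj; rewrite !mxE kj /= mulr0.
  have ui : nth x0 u i \in x :: s by apply: sub; rewrite mem_nth // su.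
  have ix : (index (nth x0 u i) (x :: s) < (size s).+1)%N by rewrite -index_mem in ui.
  rewrite (bigD1 (Ordinal ix)) //= !mxE nth_index // eqxx orbT mulr1 big1 ?addr0 //.
  move=> k kj; rewrite !mxE; case: eqP => [e|_]; last by rewrite mul0r.
  case/eqP: kj; apply: val_inj.
  rewrite [RHS](_ : _ = index (nth x0 u i) (x :: s)) // e.
  by rewrite index_uniq //= ltn_ord.
rewrite det_mulmx (_ : \det L = 1) ?mulr1 // det_trig.
  by rewrite big1 // => i _; rewrite mxE eqxx.
apply/is_trig_mxP => i j ij; rewrite mxE -!val_eqE /= ltn_eqF //.
by case: (val j) ij.
Qed.

Lemma detc_notin y s u : y \in s -> y \notin u -> size u = size s ->
  detc s u = 0.
Proof.
move=> ys yu su; have iy : (index y s < size s)%N by rewrite index_mem.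
rewrite /detc (expand_det_col _ (Ordinal iy)) big1 // => i _.
rewrite mxE /= nth_index // (_ : _ == _ = false) ?mul0r //.
by apply: contraNF yu => /eqP <-; rewrite mem_nth // su.
Qed.

Lemma detc_id s : uniq s -> detc s s = 1.
Proof.
move=> us; rewrite /detc (_ : \matrix_(_, _) _ = 1%:M) ?det1 //.
by apply/matrixP => i j; rewrite !mxE nth_uniq.
Qed.

(** [F t] plays the role of a labelled subdivision of the face [t], with labels taken from [t]. On
    tuples with entries in [t], [detc (x :: s)] is the coboundary of [detc s], so its value on [F t]
    is read on the boundary of [t], where the induction hypothesis applies. *)
Lemma sperner (ok : seq T -> Prop) (F : seq T -> (seq T -> K) -> K) :
  (forall s t, ok s -> (size t <= size s)%N -> {subset t <= s} -> ok t) ->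
  (forall phi, F [::] phi = phi [::]) ->
  (forall t, ok t ->
    chain (fun u => size u = size t /\ {subset u <= t}) (F t)) ->
  (forall t phi, ok t -> F t (cob phi) = cob (F^~ phi) t) ->
  forall s t, ok t -> uniq s -> size s = size t -> F t (detc s) = detc s t.
Proof.
move=> okS F0 cF dF; elim=> [|x s IH] t okt us st.
  by rewrite (size0nil (esym st)) F0.
(* If [t] omits an entry of [x :: s], both sides vanish; otherwise [t] and [x :: s] have the same
   entries. *)
case: (boolP (all (mem t) (x :: s))) => [/allP yxs|/allPn[y ys yt]]; last first.
  rewrite (detc_notin ys yt) //; apply: (chain0 (cF t okt)) => u [su ut].
  by apply: (detc_notin ys); rewrite ?su //; apply: contra yt => /ut.
have ts : {subset t <= x :: s}.
  have [_] := uniq_min_size us yxs (eq_leq (esym st)).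
  by move=> e z; rewrite -e.
have e u : size u = size t -> {subset u <= t} ->
    detc (x :: s) u = cob (detc s) u.
  by move=> su ut; apply: detc_cob => //; [move=> z /ut /ts|rewrite su -st].
rewrite ((cF t okt).2 _ (cob (detc s))); last by move=> u [su ut]; apply: e.
rewrite dF // e //; apply: eq_cob_in => t' st' t't.
case/andP: us => _ us.
by apply: IH => //; [apply: okS t't; rewrite // st'|move: st; rewrite /= st' => -[]].
Qed.

End DetCochain.

(** * The signed boundary operator on finite sets *)

Section Boundary.
Variables (K : fieldType) (n : nat).
Implicit Types (F G : {set 'I_n}) (a : {set 'I_n} -> K) (x y : 'I_n).

Definition sg x G : K := (-1) ^+ #|[set y in G | (y < x)%N]|.

(** The coefficient of [F] in the boundary of the chain with coefficients [a], hence a sum over the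
    sets covering [F] rather than over its faces. *)
Definition bd a F : K := \sum_(x | x \notin F) sg x F * a (x |: F).

Lemma cob_sorted (phi : seq 'I_n -> K) (s : seq 'I_n) :
  sorted (fun x y : 'I_n => (x < y)%N) s ->
  cob phi s =
  \sum_(x <- s) (-1) ^+ count (fun y : 'I_n => (y < x)%N) s * phi (rem x s).
Proof.
have tr : transitive (fun x y : 'I_n => (x < y)%N) by move=> y x z; exact: ltn_trans.
elim: s phi => [|x s IH] phi; first by rewrite big_nil.
move=> xs; have := xs => /=; rewrite path_sortedE // => /andP[/allP lex ss].
rewrite big_cons /= eqxx ltnn add0n.
have -> : count (fun y : 'I_n => (y < x)%N) s = 0%N.
  apply/eqP; rewrite -leqn0 leqNgt -has_count; apply/hasPn => y /lex.
  by rewrite -leqNgt => /ltnW.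
rewrite expr0 mul1r IH // -sumrN; congr (_ + _).
rewrite big_seq [RHS]big_seq; apply: eq_bigr => y ys; rewrite lex //=.
rewrite exprS mulN1r mulNr; case: eqP => [e|//].
by have := lex _ ys; rewrite e ltnn.
Qed.

Lemma enum_setD1 F x : enum (F :\ x) = rem x (enum F).
Proof.
rewrite rem_filter ?enum_uniq // /enum_mem -filter_predI.
by apply: eq_filter => y; rewrite /= !inE.
Qed.

(** Since [enum] lists a set increasingly, the position of a deleted entry is the exponent in [sg];
    the tuple and set conventions for signs therefore agree. *)
Lemma cob_enum (phi : seq 'I_n -> K) F :
  cob phi (enum F) = \sum_(x in F) sg x (F :\ x) * phi (enum (F :\ x)).
Proof.
rewrite cob_sorted; last first.
  apply: sorted_filter; first by move=> y x z; exact: ltn_trans.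
  rewrite -enumT; have := iota_ltn_sorted 0 n.
  by rewrite -val_enum_ord sorted_map.
rewrite -[RHS]big_enum /=; apply: eq_bigr => x _.
rewrite -enum_setD1 /sg; congr ((-1) ^+ _ * _).
rewrite cardE -size_filter /enum_mem -filter_predI; congr size.
apply: eq_filter => y; rewrite /= !inE.
by case: eqP => [->|_]; rewrite ?ltnn ?andbF //= andbC.
Qed.

End Boundary.

(** * Cones, linear duality and complementation *)

Section SimplicialExact.
Variables (K : fieldType) (n : nat).
Implicit Types (F G H T U W : {set 'I_n}) (a b e z : {set 'I_n} -> K) (x y : 'I_n).
Local Notation sg := (@sg K n).

Lemma sgU1 x y F : y \notin F -> sg x (y |: F) = (-1) ^+ (y < x)%N * sg x F.
Proof.
move=> yF; rewrite /sg; have [yx|yx] := boolP (y < x)%N.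
  rewrite (_ : [set z in y |: F | _] = y |: [set z in F | (z < x)%N]).
    by rewrite cardsU1 inE (negPf yF) /= exprD.
  by apply/setP => z; rewrite !inE andb_orl; case: eqP => [->|]; rewrite ?yx.
rewrite expr0 mul1r; congr (_ ^+ #|pred_of_set _|); apply/setP => z; rewrite !inE andb_orl.
by case: eqP => [->|//]; rewrite (negPf yx) andbF.
Qed.

Lemma sg_swap x y F : x \notin F -> y \notin F -> x != y ->
  sg x F * sg y (x |: F) = - (sg y F * sg x (y |: F)).
Proof.
move=> xF yF xy; rewrite !sgU1 //.
by case: ltngtP (xy) => [xy'|yx|/val_inj ->]; rewrite ?eqxx // => _; ring.
Qed.

Lemma sg_sqr x F : sg x F * sg x F = 1.
Proof. by rewrite -expr2 sqrr_sign. Qed.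

(** The terms with x < y are matched against those with y < x; no division by 2 occurs, so
    characteristic 2 is covered. *)
Lemma sum_antisym (g : 'I_n -> 'I_n -> K) :
  (forall x, g x x = 0) -> (forall x y, x != y -> g x y = - g y x) ->
  \sum_x \sum_y g x y = 0.
Proof.
move=> gxx gxy.
have split_ltgt x : \sum_y g x y =
    \sum_(y : 'I_n | (x < y)%N) g x y + \sum_(y : 'I_n | (y < x)%N) g x y.
  rewrite (bigID (fun y : 'I_n => (x < y)%N)) /=; congr (_ + _).
  rewrite (bigD1 x) ?ltnn //= gxx add0r; apply: eq_bigl => y.
  by rewrite -leqNgt ltn_neqAle andbC.
under eq_bigr do rewrite split_ltgt.
rewrite big_split /= [X in _ + X](exchange_big_dep xpredT) //= -big_split /=.
rewrite big1 // => x _; rewrite -big_split /= big1 // => y xy.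
by rewrite gxy ?addNr // -val_eqE neq_ltn xy.
Qed.

Lemma bd_bd a F : bd (bd a) F = 0.
Proof.
pose g x y := if [&& x \notin F, y \notin F & x != y] then
  sg x F * sg y (x |: F) * a (y |: (x |: F)) else 0.
rewrite -[RHS](@sum_antisym g).
- rewrite /bd big_mkcond /=; apply: eq_bigr => x _; rewrite /g.
  have [xF|xF] := boolP (x \in F); first by rewrite /= big1.
  rewrite mulr_sumr big_mkcond /=; apply: eq_bigr => y _.
  rewrite in_setU1 negb_or andbC eq_sym; case: ifP => // _; by rewrite mulrA.
- by move=> x; rewrite /g eqxx !andbF.
- move=> x y xy; rewrite /g [y == x]eq_sym andbCA [_ && (x != y)]andbC.
  case: (boolP (x \notin F)) => xF; case: (boolP (y \notin F)) => yF;
    rewrite /= ?andbF ?oppr0 // xy /=.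
  by rewrite setUCA sg_swap // mulNr.
Qed.

Definition cone x a G : K := if x \in G then sg x (G :\ x) * a (G :\ x) else 0.

(** Coning is a contracting homotopy of the augmented chain complex of the full simplex. When [x]
    lies in [F], the terms adding a point y outside [F] cancel in pairs by the sign rule, and the
    term of [x] itself leaves [a F]. *)
Lemma bd_cone x a F : bd (cone x a) F + cone x (bd a) F = a F.
Proof.
rewrite {1}/bd /cone; have [xF|xF] := boolP (x \in F); last first.
  rewrite addr0 (bigD1 x) //= big1 ?addr0.
    by rewrite setU11 setU1K // mulrA sg_sqr mul1r.
  move=> y /andP[yF yx]; rewrite in_setU1 eq_sym (negPf yx) (negPf xF) /=.
  by rewrite mulr0.
have -> : sg x (F :\ x) * bd a (F :\ x) =
    a F + \sum_(y | y \notin F) sg x (F :\ x) * (sg y (F :\ x) * a (y |: (F :\ x))).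
  rewrite /bd mulr_sumr (bigD1 x) ?setD11 //= setD1K // mulrA sg_sqr mul1r.
  congr (_ + _); apply: eq_bigl => y.
  by rewrite !inE; case: eqP => [->|]; rewrite ?xF ?andbF ?andbT.
rewrite addrCA -big_split /= big1 ?addr0 // => y yF.
have xy : x != y by apply: contraNneq yF => <-.
have yFx : y \notin F :\ x by rewrite !inE (negPf yF) andbF.
rewrite in_setU1 xF orbT.
have -> : (y |: F) :\ x = y |: (F :\ x).
  by rewrite setDUl; congr (_ :|: _); apply/setDidPl; rewrite disjoints1 !inE eq_sym.
rewrite !mulrA -mulrDl [X in X * _](_ : _ = 0) ?mul0r //.
have sF : sg y F = (-1) ^+ (x < y)%N * sg y (F :\ x) by rewrite -sgU1 ?setD11 // setD1K.
rewrite sF.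
rewrite sgU1 //; rewrite -val_eqE neq_ltn in xy.
by case/orP: xy => lt_xy; rewrite lt_xy ltnNge ltnW //=; ring.
Qed.

Lemma bd_cone_cycle x a : (forall F, bd a F = 0) -> forall F, bd (cone x a) F = a F.
Proof.
move=> da F; rewrite -[RHS](bd_cone x).
by rewrite [cone x (bd a) F]/cone da mulr0 if_same addr0.
Qed.

(* Transposes the injectivity of the boundary map on chains carried by C. *)
Lemma coboundary_onto (C : {set {set 'I_n}}) :
  (forall z, (forall F, z F != 0 -> F \in C) -> (forall G, bd z G = 0) ->
     forall F, z F = 0) ->
  forall b, exists e, {in C, forall T, \sum_(x in T) sg x (T :\ x) * e (T :\ x) = b T}.
Proof.
move=> inj b.
pose M : 'M[K]_(#|C|, #|{: {set 'I_n}}|) := \matrix_(i, j)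
  \sum_(x | (x \in (enum_val i : {set 'I_n})) && (enum_val j == enum_val i :\ x))
    sg x (enum_val j).
(* Row i of [M] is the boundary of the i-th circuit, so a left kernel vector is a cycle carried by
   [C] and must vanish. The resulting right inverse [B], applied to [b], solves the system. *)
have /row_freeP[B MB] : row_free M.
  rewrite -kermx_eq0; apply/eqP/row_matrixP => k; rewrite row0.
  set u := row k _; have uM : u *m M = 0 by rewrite -row_mul mulmx_ker row0.
  pose z F := \sum_(i | enum_val i == F) u 0 i.
  have z0 : forall F, z F = 0.
    apply: inj => [F|G].
      apply: contraNT => FC; rewrite /z big1 // => i /eqP iF.
      by move: FC; rewrite -iF enum_valP.
    have := congr1 (fun A : 'rV_ _ => A 0 (enum_rank G)) uM; rewrite !mxE => <-.
    rewrite /bd; under eq_bigr do rewrite mulr_sumr.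
    rewrite (exchange_big_dep xpredT) //=; apply: eq_bigr => k' _.
    rewrite !mxE mulr_sumr; apply: eq_big => [x|x _].
      rewrite enum_rankK; apply/andP/andP => -[]; last first.
        by move=> xT /eqP ->; rewrite setD11 setD1K.
      by move=> xG /eqP ->; rewrite setU11 setU1K.
    by rewrite enum_rankK mulrC.
  apply/rowP => i; rewrite [RHS]mxE -[RHS](z0 (enum_val i)) /z (big_pred1 i) // => j.
  by rewrite (inj_eq enum_val_inj).
pose v := B *m \col_i b (enum_val i).
exists (fun G => v (enum_rank G) 0) => T TC.
have Mv : M *m v = \col_i b (enum_val i) by rewrite mulmxA MB mul1mx.
have := congr1 (fun A : 'cV_ _ => A (enum_rank_in TC T) 0) Mv.
rewrite ![in X in X -> _]mxE enum_rankK_in // => <-.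
under [RHS]eq_bigr do rewrite [M _ _]mxE enum_rankK_in // mulr_suml.
rewrite (exchange_big_dep (mem T)) /=; last by move=> j x _ /andP[].
apply: eq_bigr => x xT; rewrite (big_pred1 (enum_rank (T :\ x))) ?enum_rankK // => j.
by rewrite xT /= -(inj_eq enum_rank_inj) enum_valK.
Qed.

Lemma bdB a b F : bd (fun G => a G - b G) F = bd a F - bd b F.
Proof. by rewrite /bd -sumrB; apply: eq_bigr => x _; rewrite mulrBr. Qed.

Lemma bd_neq0 a F : bd a F != 0 -> exists2 x, x \notin F & a (x |: F) != 0.
Proof.
move=> bF; have [x /andP[xF ax]|a0] := pickP (fun x => (x \notin F) && (a (x |: F) != 0)).
  by exists x.
case/eqP: bF; rewrite /bd big1 // => x xF.
by have := a0 x; rewrite xF /= => /negbFE/eqP ->; rewrite mulr0.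
Qed.

Lemma sgU x (A B : {set 'I_n}) : [disjoint A & B] -> sg x (A :|: B) = sg x A * sg x B.
Proof.
move=> AB; rewrite /sg -exprD -cardsUI; congr (_ ^+ _).
rewrite [X in (_ + X)%N](_ : _ = 0%N) ?addn0.
  by congr #|pred_of_set _|; apply/setP => y; rewrite !inE andb_orl.
apply/eqP; rewrite cards_eq0; apply/eqP/setP => y; rewrite !inE.
by move: AB => /pred0P/(_ y) /= AB; rewrite andbACA AB.
Qed.

Lemma sgD1 x F : sg x (F :\ x) = sg x F.
Proof.
rewrite /sg; congr (_ ^+ #|pred_of_set _|); apply/setP => y; rewrite !inE.
by have [->|] := eqVneq y x; rewrite ?ltnn ?andbF //.
Qed.

(** Complementation in [W] exchanges boundary and coboundary up to sign. The twist by products of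
    [sg y W] absorbs the discrepancy, because [sg x W] is the product of the signs of [x] in [T] and
    in its complement. *)
Lemma bd_complement e W T : T \subset W ->
  bd (fun H => if H \subset W then
        (\prod_(y in W :\: H) sg y W) * e (W :\: H) else 0) (W :\: T) =
  (\prod_(y in T) sg y W) * \sum_(x in T) sg x (T :\ x) * e (T :\ x).
Proof.
move=> TW; rewrite /bd mulr_sumr big_mkcond [RHS]big_mkcond /=.
apply: eq_bigr => x _.
have [xT|xT] := boolP (x \in T); last first.
  rewrite !inE (negPf xT) /=; have [//|xW] := boolP (x \in W).
  by rewrite subUset sub1set (negPf xW) mulr0.
rewrite !inE xT subUset sub1set (subsetP TW) // subsetDl /=.
have -> : W :\: (x |: W :\: T) = T :\ x.
  apply/setP => y; rewrite !inE negb_or negb_and negbK.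
  by case: (boolP (y \in T)) => [/(subsetP TW) ->|_]; rewrite ?andbT //=;
    case: (y \in W); rewrite ?andbF.
rewrite (big_setD1 x xT) /= !mulrA; congr (_ * _).
have -> : sg x W = sg x (T :\ x) * sg x (W :\: T).
  rewrite sgD1 -sgU; last by rewrite -setI_eq0 setDE setICA setICr setI0.
  by rewrite -{1}(setID W T) (setIidPr TW).
rewrite sgD1 mulrAC -[LHS]mul1r -(sg_sqr x T).
ring.
Qed.

(* Alexander duality inside W: passing to complements turns the obstruction to
   c being good into a cochain on the circuits, which is a coboundary. *)
Lemma clutter_exact (C : {set {set 'I_n}}) (d i : nat) (good : pred {set 'I_n}) W a :
  (forall z, (forall F, z F != 0 -> F \in C) -> (forall G, bd z G = 0) ->
     forall F, z F = 0) ->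
  (forall U, (d < #|U|)%N -> good U) ->
  (forall U, #|U| = d -> U \notin C -> good U) ->
  (i + d < #|W|)%N ->
  (forall F, a F != 0 -> #|F| = i /\ F \subset W) ->
  (forall F, bd a F = 0) ->
  exists2 c, (forall F, bd c F = a F) &
    forall G, c G != 0 -> [/\ #|G| = i.+1, G \subset W & good (W :\: G)].
Proof.
move=> inj good_gt good_eq ltW aW da.
have /card_gt0P[x xW] : (0 < #|W|)%N by apply: leq_ltn_trans ltW.
have c0W G : cone x a G != 0 -> #|G| = i.+1 /\ G \subset W.
  rewrite /cone; case: ifP => [xG|_]; last by rewrite eqxx.
  rewrite mulf_eq0 negb_or => /andP[_ /aW[Gi GW]].
  by rewrite (cardsD1 x) xG Gi -(setD1K xG) subUset sub1set xW.
have cardWD G : #|G| = i.+1 -> G \subset W -> #|W :\: G| = (#|W| - i.+1)%N.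
  by move=> Gi GW; rewrite cardsD (setIidPr GW) Gi.
have dc0 := bd_cone_cycle x da.
(* The complement of a set in the support of the cone has #|W| - (i+1) points. If this exceeds d it
   is good, and the cone itself works. *)
have [lt_d|le_d] := ltnP (i.+1 + d) #|W|.
  exists (cone x a) => // G /c0W[Gi GW]; split=> //; apply: good_gt.
  by rewrite cardWD // ltn_subRL.
have eqW : #|W| = (i.+1 + d)%N by apply/eqP; rewrite eqn_leq le_d addSn.
pose tau T : K := \prod_(y in T) sg y W.
have tau_sqr T : tau T * tau T = 1.
  by rewrite -big_split /= big1 // => y _; rewrite sg_sqr.
have [e0 e0P] := coboundary_onto inj (fun T => tau T * cone x a (W :\: T)).
(* In the remaining case these complements have exactly d points, and a boundary [bd e] is
   subtracted to cancel the cone wherever the complement is a circuit. Since [e0] is arbitrary on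
   other cardinalities, it is cut down to (d-1)-sets, which keeps [bd e] on sets of size i+1. *)
pose e1 U := if #|U|.+1 == d then e0 U else 0.
pose e H := if H \subset W then tau (W :\: H) * e1 (W :\: H) else 0.
exists (fun G => cone x a G - bd e G) => [F|G].
  by rewrite bdB bd_bd subr0.
have deW : bd e G != 0 -> #|G| = i.+1 /\ G \subset W.
  case/bd_neq0 => y yG; rewrite /e subUset sub1set.
  case: ifP => [/andP[yW GW]|_]; last by rewrite eqxx.
  rewrite /e1; case: ifP => [/eqP WyG _|_]; last by rewrite mulr0 eqxx.
  have := cardsID (y |: G) W; rewrite (setIidPr _) ?subUset ?sub1set ?yW //.
  by rewrite cardsU1 yG add1n => cardW; split=> //; move: eqW; rewrite -cardW -WyG; lia.
move=> cG.
have [Gi GW] : #|G| = i.+1 /\ G \subset W.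
  have [c0|/c0W//] := eqVneq (cone x a G) 0.
  by apply: deW; move: cG; rewrite c0 sub0r oppr_eq0.
split=> //.
have WG : #|W :\: G| = d by rewrite cardWD // eqW addKn.
have [TC|/good_eq->//] := boolP (W :\: G \in C).
have WWG : W :\: (W :\: G) = G by rewrite setDDr setDv set0U (setIidPr GW).
case/eqP: cG; apply/eqP; rewrite subr_eq0; apply/eqP.
rewrite -{2}WWG bd_complement ?subsetDl //.
transitivity (tau (W :\: G) * \sum_(y in W :\: G)
    sg y ((W :\: G) :\ y) * e0 ((W :\: G) :\ y)).
  by rewrite e0P // WWG mulrA tau_sqr mul1r.
congr (_ * _); apply: eq_bigr => y yT.
by move: WG; rewrite /e1 (cardsD1 y) yT add1n => ->; rewrite eqxx.
Qed.

End SimplicialExact.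
End Simplicial.

(** * Top-dimensional cycles of contractible complexes *)
Module Homotopy.
Import Simplicial all_classical all_reals all_analysis.
Import Order.TTheory GRing.Theory Num.Theory numFieldNormedType.Exports.
Local Open Scope classical_set_scope.
Local Open Scope ring_scope.
Import Topology.

(** Heine-Cantor relative to a subspace: only points of [A] are compared, so [f] may be arbitrary
    outside [A]. *)
Lemma compact_unif_continuous (R : realType) (U V : pseudoMetricType R)
    (A : set U) (f : U -> V) : compact A -> {within A, continuous f} ->
  forall e : R, 0 < e -> exists2 d : R, 0 < d &
    forall x y, A x -> A y -> ball x d y -> ball (f x) e (f y).
Proof.
move=> /compact_near_coveringP cA /subspace_continuousP cf e e0.
pose P (d : R) x := A x -> forall y, A y -> ball x d y -> ball (f x) e (f y).
have : \forall d \near 0^'+, A `<=` P d.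
  apply: cA => x Ax; have e20 : 0 < e / 2 by rewrite divr_gt0.
  have := cf x Ax _ (nbhsx_ballx (f x) (e / 2) e20).
  rewrite /= /nbhs /= /within /= => /nbhs_ballP[r r0 rB].
  have r20 : 0 < r / 2 by rewrite divr_gt0.
  near=> x' d => Ax' y Ay x'y.
  have xx' : ball x (r / 2) x' by near: x'; exact: nbhsx_ballx.
  have dr : d <= r / 2 by near: d; exact: nbhs_right_le.
  have fr z : A z -> ball x r z -> ball (f x) (e / 2) (f z).
    by move=> Az xz; exact: rB.
  apply: (@ball_splitr _ _ (f x)); apply: fr => //.
    by apply: le_ball xx'; rewrite ler_pdivrMr // ler_peMr ?ler1n // ltW.
  by apply: (@ball_split _ _ x') => //; exact: le_ball x'y.
move=> near0.
have [d [d0 dP]] : exists d, 0 < d /\ A `<=` P d.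
  near (0 : R)^'+ => d; exists d; split; last by near: d.
  by near: d; exact: nbhs_right_gt.
by exists d => // x y Ax; apply: dP.
Unshelve. all: by end_near. Qed.


(** * Compactness of the realization and small subdivisions of faces *)

Section Realization.
Variables (R : realType) (n : nat) (D : {set {set 'I_n}}).
Local Notation T := 'rV[R]_n.
Hypothesis subD : forall F G : {set 'I_n}, F \in D -> G \subset F -> G \in D.

Lemma realization_le1 (x : T) i : realization R D x -> x 0 i <= 1.
Proof.
case=> x0 x1 _; rewrite -x1 (bigD1 i) //= lerDl.
by apply: sumr_ge0.
Qed.


Lemma compact_realization : compact (realization R D : set T).
Proof.
pose cube := [set v : T | forall i, `[0 : R, 1]%classic (v ord0 i)].
have cube_compact : compact cube.
  by apply: (@rV_compact R n (fun=> `[0 : R, 1]%classic)) => _; exact: segment_compact.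
apply: (subclosed_compact _ cube_compact); last first.
  move=> x xD i /=; rewrite in_itv /= realization_le1 // andbT.
  by case: xD.
have -> : realization R D = (\bigcap_(i in [set: 'I_n]) [set x : T | 0 <= x 0 i]) `&`
    [set x : T | \sum_i x 0 i = 1] `&`
    [set x : T | [set i | x 0 i != 0]%SET \in D].
  apply/seteqP; split=> [x [x0 x1 xD]|x [[x0 x1] xD]].
    by split=> //; split=> // i _; apply: x0.
  by split=> // i; apply: x0.
apply: closedI; first apply: closedI.
- apply: closed_bigI => i _.
  rewrite (_ : [set x : T | _] = (fun x : T => x 0 i) @^-1` [set y : R | 0 <= y]) //.
  apply: preimage_closed; last exact: closed_ge.
  by move=> x _; exact: coord_continuous.
- rewrite (_ : [set x : T | _] = (fun x : T => \sum_i x 0 i) @^-1` [set y : R | y = 1]) //.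
  apply: preimage_closed; last exact: closed_eq.
  move=> x _.
  apply: (@continuous_big R 'I_n +%R 0 xpredT add_continuous T _
    (fun i (y : T) => y 0 i)) => i _.
  exact: coord_continuous.
(* Nonzero coordinates stay nonzero nearby, so supports can only grow near [x]; as [D] is closed
   under subsets, having a support outside [D] is an open condition. *)
- rewrite -[X in closed X]setCK; apply: open_closedC; rewrite openE => x xD.
  have near_nz i : \forall y \near x, x 0 i != 0 -> (y : T) 0 i != 0.
    have [x0i|xi] := eqVneq (x 0 i) 0; first by near=> y.
    near=> y => /= _; near: y.
    apply: (@coord_continuous R 1 n 0 i x [set z : R | z != 0]).
    by apply: open_nbhs_nbhs; split; [exact: open_neq|].
  have near_supp := filter_forall (nbhs_filter x) near_nz.
  apply: filterS near_supp => y xy /= yD; apply: xD => /=.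
  by apply: subD yD _; apply/fintype.subsetP => i; rewrite !inE; exact: xy.
Unshelve. all: by end_near. Qed.

Definition close (e : R) (x y : T) : Prop := forall i, `|x 0 i - y 0 i| < e.

Definition face_points (s : seq 'I_n) (x : T) : Prop :=
  realization R D x /\ forall i, x 0 i != 0 -> i \in s.

Lemma in_face_points (s : seq 'I_n) (x : T) : [set i in s]%SET \in D ->
  (forall i, 0 <= x 0 i) -> \sum_i x 0 i = 1 ->
  (forall i, x 0 i != 0 -> i \in s) -> face_points s x.
Proof.
move=> sD x0 x1 xs; split=> //; split=> //; apply: subD sD _.
by apply/fintype.subsetP => i; rewrite !inE; exact: xs.
Qed.

Lemma face_points_vertex s v : [set i in s]%SET \in D -> v \in s ->
  face_points s (delta_mx 0 v).
Proof.
move=> sD vs; apply: in_face_points => // [i||i].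
- by rewrite mxE ler0n.
- rewrite (bigD1 v) //= mxE !eqxx big1 ?addr0 // => i iv.
  by rewrite mxE (negPf iv) andbF.
- by rewrite mxE /=; case: (i =P v) => [->//|_]; rewrite eqxx.
Qed.

Definition segment (a : R) (p x : T) : T := (1 - a) *: x + a *: p.

Lemma face_points_segment s a p x : [set i in s]%SET \in D -> 0 <= a <= 1 ->
  face_points s p -> face_points s x -> face_points s (segment a p x).
Proof.
move=> sD /andP[a0 a1] [[p0 p1 _] ps] [[x0 x1 _] xs].
apply: in_face_points => // [i||i].
- by rewrite !mxE addr_ge0 // mulr_ge0 // subr_ge0.
- under eq_bigr do rewrite !mxE.
  by rewrite big_split /= -!mulr_sumr x1 p1 !mulr1 subrK.
- rewrite !mxE; have [xi|xi _] := eqVneq (x 0 i) 0; last exact: xs.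
  by rewrite xi mulr0 add0r mulf_eq0 negb_or => /andP[_ /ps].
Qed.

(** Half of [e] pays for moving the point, with weight 1 - a at most 1, and half for moving the
    time, since the coordinates of [p] and [y] lie in [0, 1]. *)
Lemma close_segment (e a b : R) p x y : 0 <= a <= 1 -> `|a - b| < e / 2 ->
  realization R D p -> realization R D y -> close (e / 2) x y ->
  close e (segment a p x) (segment b p y).
Proof.
move=> /andP[a0 a1] ab pD yD xy i; rewrite !mxE.
have -> : (1 - a) * x 0 i + a * p 0 i - ((1 - b) * y 0 i + b * p 0 i) =
  (1 - a) * (x 0 i - y 0 i) + (a - b) * (p 0 i - y 0 i) by ring.
apply: le_lt_trans (ler_normD _ _) _; rewrite (splitr e).
apply: ltr_leD.
  rewrite normrM (ger0_norm (x := 1 - a)) ?subr_ge0 //.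
  apply: le_lt_trans (xy i); rewrite ler_piMl // gerBl //.
apply: le_trans (ltW ab); rewrite normrM ler_piMr // ler_norml.
have [p0 _ _] := pD; have [y0 _ _] := yD.
have := p0 i; have := y0 i.
have := realization_le1 i pD; have := realization_le1 i yD.
by move=> *; apply/andP; split; lra.
Qed.

Lemma close_steps (e : R) : 0 < e -> exists2 N : nat, (0 < N)%N &
  forall i j : nat, (j <= i.+1)%N -> (i <= j.+1)%N ->
    `|i%:R / N%:R - j%:R / N%:R| < e :> R.
Proof.
move=> e0; exists (Num.truncn e^-1).+1 => // i j ji ij.
rewrite -mulrBl normrM normfV [in X in _ / X]ger0_norm ?ler0n //.
rewrite ltr_pdivrMr ?ltr0n //.
apply: (@le_lt_trans _ _ 1).
  have ji' : j%:R <= i%:R + 1 :> R by rewrite natr1 ler_nat.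
  have ij' : i%:R <= j%:R + 1 :> R by rewrite natr1 ler_nat.
  by rewrite ler_norml; apply/andP; split; lra.
rewrite mulrC -ltr_pdivrMr // div1r.
by apply: truncnS_gt.
Qed.

(** Faces are filled by increasing size. The chain already attached to the boundary of [s] is a
    cycle of tuples close up to e/2, and the straight-line contraction of the face to its first
    vertex bounds it by tuples close up to [e]; each dimension thus costs a factor 2. *)
Lemma small_subdivision (K : fieldType) m (e : R) : 0 < e ->
  exists f : seq 'I_n -> (seq T -> K) -> K,
    (forall phi, f [::] phi = phi [::]) /\
    forall s, (size s <= m)%N -> [set i in s]%SET \in D ->
      chain (small (face_points s) (close e) (size s)) (f s) /\
      forall phi, f s (cob phi) = cob (f^~ phi) s.
Proof.
elim: m e => [|m IH] e e0.
  exists (fun _ phi => phi [::]); split=> // -[|//] _ _; split=> //.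
  by split=> // phi psi; apply.
have e20 : 0 < e / 2 by rewrite divr_gt0.
have [f [f0 fP]] := IH _ e20.
(* Stated for every [s], with the zero functional where there is nothing to fill, so that the
   fillings can be chosen simultaneously. *)
have ext s : exists W : (seq T -> K) -> K, size s = m.+1 ->
    [set i in s]%SET \in D ->
    chain (small (face_points s) (close e) m.+1) W /\
    forall phi, cob (f^~ phi) s = W (cob phi).
  have [ss|ss] := eqVneq (size s) m.+1; last first.
    by exists (fun=> 0) => /eqP; rewrite (negPf ss).
  have [sD|sD] := boolP ([set i in s]%SET \in D); last by exists (fun=> 0).
  suff [W cW dW] : exists2 W, chain (small (face_points s) (close e) m.+1) W &
      forall phi, cob (f^~ phi) s = W (cob phi) by exists W.
  have face t : size s = (size t).+1 -> {subset t <= s} ->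
      chain (small (face_points s) (close (e / 2)) m) (f t) /\
      forall phi, f t (cob phi) = cob (f^~ phi) t.
    rewrite ss => -[st] ts.
    have [||ct dt] := fP t; first by rewrite st.
      apply: subD sD _; apply/fintype.subsetP => i; rewrite !inE; exact: ts.
    split=> //; apply: chain_sub ct => u [su uX uE]; split=> //; first by rewrite su.
    by move=> x /uX[xD xt]; split=> // i /xt /ts.
  case: s ss sD face => [//|v s] ss sD face.
  have vs : v \in v :: s by rewrite mem_head.
  have pX := face_points_vertex sD vs.
  set p := delta_mx 0 v in pX.
  have [N N0 step] := close_steps e20.
  have in01 i : (i <= N)%N -> 0 <= (i%:R / N%:R : R) <= 1.
    by move=> iN; rewrite divr_ge0 ?ler0n //= ler_pdivrMr ?ltr0n // mul1r ler_nat.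
  apply: (@homotopic_cycle_bounds _ _ _ (close (e / 2)) _ N
    (fun i => segment (i%:R / N%:R) p) p) => //.
  - by move=> i x iN xX; apply: face_points_segment => //; exact: in01.
  - by move=> x xX; rewrite /segment mul0r subr0 scale1r scale0r addr0.
  - move=> x xX; rewrite /segment divff ?subrr ?scale0r ?add0r ?scale1r //.
    by rewrite pnatr_eq0 -lt0n.
  - move=> i x y iN [xD _] [yD _] xy; apply: close_segment => //; first exact: in01.
      exact: (step i i (leqnSn i) (leqnSn i)).
    by case: pX.
  - move=> i x y iN [xD _] [yD _] xy; split.
      apply: close_segment => //; [exact: (in01 i (ltnW iN))| |by case: pX].
      exact: (step i i.+1 (leqnn _) (leqW (leqnSn i))).
    apply: close_segment => //; [exact: in01| |by case: pX|].
      exact: (step i.+1 i (leqW (leqnSn i)) (leqnn _)).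
    by move=> k; rewrite distrC.
  - by move=> i; rewrite subrr normr0.
  - split=> [a phi psi|phi psi epp].
      rewrite -cob_linear; apply: eq_cob_in => t st ts.
      by have [ct _] := face t st ts; rewrite ct.1.
    apply: eq_cob_in => t st ts.
    by have [ct _] := face t st ts; exact: ct.2.
  (* The chain to be filled is a cycle: [f] commutes with boundaries on the proper faces, and the
     boundary of a boundary is 0. *)
  - move=> phi; rewrite -[RHS](@cob_cob K _ (f^~ phi) (v :: s)).
    by apply: eq_cob_in => t st ts; have [_ ->] := face t st ts.
have [W WP] := choice ext.
exists (fun s => if (size s <= m)%N then f s else W s); split=> [phi//|s sm sD].
have facets_f phi : cob (fun t => (if (size t <= m)%N then f t else W t) phi) s =
    cob (f^~ phi) s.
  by apply: eq_cob_in => t st _; rewrite -ltnS -st sm.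
case: ifP => [sm'|/negbT]; last rewrite -ltnNge => ms.
  have [cf df] := fP s sm' sD; split; last by move=> phi; rewrite facets_f df.
  apply: chain_sub cf => u [su uX uE]; split=> // x y xu yu i.
  apply: lt_le_trans (uE x y xu yu i) _.
  by rewrite ler_pdivrMr // ler_peMr ?ler1n // ltW.
have ss : size s = m.+1 by apply/eqP; rewrite eqn_leq sm.
have [cW dW] := WP s ss sD; rewrite ss; split=> // phi.
by rewrite facets_f dW.
Qed.

Lemma realization_dim_gt0 (x : T) : realization R D x -> (0 < n)%N.
Proof.
case=> _ x1 _; rewrite lt0n; apply/eqP => n0; move: x1; rewrite big1 => [/eqP|i _].
  by rewrite eq_sym oner_eq0.
by have := ltn_ord i; rewrite [X in (_ < X)%N]n0.
Qed.

Lemma large_coord (x : T) : realization R D x -> exists i, n%:R^-1 <= x 0 i.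
Proof.
move=> xD; have n0 := realization_dim_gt0 xD; have [_ x1 _] := xD.
apply: contrapT => /forallNP lt_x.
have : \sum_i x 0 i < \sum_(i < n) (n%:R^-1 : R).
  apply: ltr_sum => [|i _]; last by rewrite ltNge; apply/negP/lt_x.
  by apply/hasP; exists (Ordinal n0) => //; rewrite mem_index_enum.
rewrite x1 sumr_const card_ord -[X in _ < X]mulr_natr mulVf ?ltxx //.
by rewrite pnatr_eq0 -lt0n.
Qed.

End Realization.

(** * Vanishing of the top-dimensional cycles *)

Lemma cycles_trivial (R : realType) (n d : nat) (D : {set {set 'I_n}})
    (K : fieldType) (z : {set 'I_n} -> K) :
  (forall F G : {set 'I_n}, F \in D -> G \subset F -> G \in D) ->
  (forall F, F \in D -> (#|F| <= d)%N) ->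
  contractible_complex R D ->
  (forall F, z F != 0 -> F \in D /\ #|F| = d) ->
  (forall G, bd z G = 0) -> forall F, z F = 0.
Proof.
move=> subD leD [p Dp [H [Hcont HD H0 H1]]] zD dz F0.
have [//|F0z] := eqVneq (z F0) 0; have [F0D F0d] := zD _ F0z.
pose T := 'rV[R]_n.
have n0 := realization_dim_gt0 Dp.
have ex_v (x : T) : exists i, realization R D x -> n%:R^-1 <= x 0 i.
  have [xD|xD] := pselect (realization R D x); last by exists (Ordinal n0).
  by have [i] := large_coord xD; exists i.
have [v vP] := choice ex_v.
(* The largest coordinate of a point is at least 1/n; hence if [y] is closer than 1/n to [x], the
   label [v y] belongs to the support of [x]. *)
pose e : R := n%:R^-1.
have e0 : 0 < e by rewrite invr_gt0 ltr0n.
have v_supp x : realization R D x -> x 0 (v x) != 0.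
  by move=> /vP; apply: contraTneq => ->; rewrite -ltNge.
have cK := compact_setX (@compact_realization R n D subD) (@segment_compact R 0 1).
have [r r0 rP] := compact_unif_continuous cK Hcont e0.
have [N N0 step] := close_steps r0.
have [f [f0 fP]] := @small_subdivision R n D subD K d r r0.
have enum_ok F : F \in D -> [set i in enum F]%SET \in D.
  by rewrite (_ : [set i in enum F]%SET = F) //; apply/setP => i; rewrite inE mem_enum.
have enum_size F : F \in D -> (size (enum F) <= d)%N by rewrite -cardE; exact: leD.
pose X : T -> Prop := realization R D.
pose Z phi := \sum_F z F * f (enum F) phi.
have cZ : chain (small X (close r) d) Z.
  have cf F : z F != 0 -> chain (small X (close r) d) (f (enum F)).
    move=> /zD[FD Fd]; have [cf _] := fP _ (enum_size _ FD) (enum_ok _ FD).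
    apply: chain_sub cf => u [su uX uE]; split=> //; first by rewrite su -cardE.
    by move=> x /uX[].
  split=> [a phi psi|phi psi ee].
    rewrite mulr_sumr -big_split /=; apply: eq_bigr => F _.
    have [->|zF] := eqVneq (z F) 0; first by rewrite !mul0r mulr0 addr0.
    by rewrite (cf F zF).1; ring.
  apply: eq_bigr => F _; have [->|zF] := eqVneq (z F) 0; first by rewrite !mul0r.
  by rewrite ((cf F zF).2 _ _ ee).
have dZ phi : Z (cob phi) = 0.
  rewrite /Z.
  have -> : \sum_F z F * f (enum F) (cob phi) =
      \sum_(F : {set 'I_n}) \sum_(x in F)
        z F * (sg K x (F :\ x)%SET * f (enum (F :\ x)%SET) phi).
    apply: eq_bigr => F _; rewrite -mulr_sumr.
    have [->|/zD[FD Fd]] := eqVneq (z F) 0; first by rewrite !mul0r.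
    have [_ ->] := fP _ (enum_size _ FD) (enum_ok _ FD).
    by rewrite cob_enum.
  rewrite (exchange_big_dep xpredT) //=.
  have -> : \sum_(x : 'I_n) \sum_(F : {set 'I_n} | x \in F)
        z F * (sg K x (F :\ x)%SET * f (enum (F :\ x)%SET) phi) =
      \sum_(x : 'I_n) \sum_(G : {set 'I_n} | x \notin G)
        f (enum G) phi * (sg K x G * z (x |: G)%SET).
    apply: eq_bigr => x _.
    rewrite (reindex_onto (fun G : {set 'I_n} => x |: G)%SET (fun F => F :\ x)%SET) /=;
      last by move=> F xF; rewrite finset.setD1K.
    apply: eq_big => [G|G].
      rewrite !inE eqxx /=; apply/eqP/idP => [<-|xG]; first by rewrite !inE eqxx.
      by rewrite setU1K.
    by move=> /andP[_ /eqP ->]; ring.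
  rewrite (exchange_big_dep xpredT) //= big1 // => G _.
  by rewrite -mulr_sumr [X in _ * X](dz G) mulr0.
have in01 i : (i <= N)%N -> 0 <= (i%:R / N%:R : R) <= 1.
  by move=> iN; rewrite divr_ge0 ?ler0n //= ler_pdivrMr ?ltr0n // mul1r ler_nat.
have Hclose i j x y : (i <= N)%N -> (j <= N)%N -> (j <= i.+1)%N -> (i <= j.+1)%N ->
    X x -> X y -> close r x y -> close e (H (x, i%:R / N%:R)) (H (y, j%:R / N%:R)).
  move=> iN jN ji ij xX yX xy.
  have : ball (x, (i%:R / N%:R : R)) r (y, j%:R / N%:R).
    split; last exact: (step i j ji ij).
    by split=> // k l; rewrite ord1; exact: xy.
  have inK k w : (k <= N)%N -> X w ->
      (realization R D `*` `[0, 1]) (w, (k%:R / N%:R : R)).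
    by move=> kN wX; split=> //=; rewrite in_itv /=; exact: in01.
  by move=> /(rP _ _ (inK _ _ iN xX) (inK _ _ jN yX))[_ close_xy] k; exact: close_xy.
have [W cW dW] : exists2 W, chain (small X (close e) d.+1) W &
    forall phi, Z phi = W (cob phi).
  apply: (@homotopic_cycle_bounds K _ X (close r) (close e) N
    (fun i x => H (x, i%:R / N%:R)) p) => //.
  - by move=> i x iN xX; apply: HD => //; exact: in01.
  - by move=> x xX; rewrite mul0r; exact: H0.
  - by move=> x xX; rewrite divff ?pnatr_eq0 -?lt0n //; exact: H1.
  - by move=> i x y iN xX yX xy; apply: Hclose.
  - move=> i x y iN xX yX xy; split; apply: Hclose => //.
    + exact: ltnW.
    + exact: leqW.
    + exact: ltnW.
    + exact: leqW.
    + by move=> k; rewrite distrC.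
  - by move=> i; rewrite subrr normr0.
(* The cochain [A \o map v] is evaluated on [Z] in two ways: it gives 0 because [Z] bounds, and
   [z F0] by Sperner's lemma. *)
pose s0 := enum F0; pose A := detc K (Ordinal n0) s0.
have ZA0 : Z (A \o map v) = 0.
  rewrite dW; apply: (chain0 cW) => u [su uX uE].
  rewrite cob_map; apply: cob_detc_nuniq; first by rewrite size_map su -cardE F0d.
  (* All d+1 labels lie in the support of the first point, a face with at most d vertices, so two of
     them coincide. *)
  case: u su uX uE => [//|x u] su uX uE; apply/negP => uu.
  have xX : X x by apply: uX; rewrite mem_head.
  have [x0 _ xD] := xX.
  have /leq_trans/(_ (leD _ xD)) : (d.+1 <= #|[set i | x 0%R i != 0%R]%SET|)%N.
    rewrite -su -(size_map v) -(card_uniqP uu).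
    apply/subset_leq_card/fintype.subsetP => i /mapP[y yu ->]; rewrite inE.
    have := uE x y (mem_head _ _) yu (v y); have := vP y (uX y yu).
    move=> vy; apply: contraTneq => ->; rewrite sub0r normrN -leNgt.
    by apply: le_trans vy _; exact: ler_norm.
  by rewrite ltnn.
have sp F : F \in D -> #|F| = d -> f (enum F) (A \o map v) = A (enum F).
  move=> FD Fd.
  (* The subdivided face relabelled by [v]. A label lies in the support of its point, hence among
     the vertices of [t]: this is Sperner's condition. *)
  pose g t (phi : seq 'I_n -> K) := f t (phi \o map v).
  pose ok (t : seq 'I_n) := [set i in t]%SET \in D /\ (size t <= d)%N.
  apply: (@sperner K _ (Ordinal n0) ok g); rewrite ?enum_uniq //.
  - move=> s t [sD sd] ts sub; split; last exact: leq_trans sd.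
    by apply: subD sD _; apply/fintype.subsetP => i; rewrite !inE => /sub.
  - by move=> phi; rewrite /g f0.
  - move=> t [tD td]; have [ct _] := fP t td tD; split=> [a phi psi|phi psi ee].
      by rewrite /g -ct.1.
    apply: ct.2 => u [su uX _] /=; apply: ee; rewrite size_map su; split=> //.
    by move=> i /mapP[x xu ->]; have [xD xt] := uX x xu; apply/xt/v_supp.
  - move=> t phi [tD td]; have [_ dt] := fP t td tD; rewrite /g -dt.
    by have [ct _] := fP t td tD; apply: ct.2 => u _ /=; rewrite -cob_map.
  - by split; [exact: enum_ok|exact: enum_size].
  - by rewrite -!cardE F0d Fd.
rewrite -{}ZA0 /Z (bigD1 F0) //= sp // /A detc_id ?enum_uniq // mulr1 big1 ?addr0 //.
move=> F FF0; have [->|/zD[FD Fd]] := eqVneq (z F) 0; first by rewrite mul0r.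
rewrite sp // /A.
have : ~~ (F0 \subset F).
  by apply: contra FF0 => sF; rewrite eq_sym eqEcard sF F0d Fd leqnn.
case/fintype.subsetPn => y yF0 yF.
by rewrite (@detc_notin K _ (Ordinal n0) y) ?mulr0 ?mem_enum // -!cardE F0d.
Qed.

End Homotopy.

(** * The Koszul complex and Betti numbers of circuit ideals *)
Module Koszul.
Import Simplicial mpoly Resolutions.
Import GRing.Theory.
Local Open Scope ring_scope.

(** * Monomial ideals and their supports *)

Section Monomials.
Variables (K : fieldType) (n : nat).
Local Notation S := {mpoly K[n]}.
Implicit Types (F G H T U : {set 'I_n}) (m b : 'X_{1..n}) (p q : S).

Lemma mesym1E F i : mesym1 F i = (i \in F) :> nat.
Proof. by rewrite mnmE. Qed.

Lemma le_mesym1 F b : (mesym1 F <= b)%MM = (F \subset [set i | (0 < b i)%N]).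
Proof.
apply/mnm_lepP/subsetP => [le_b i iF|sub i].
  by have := le_b i; rewrite mesym1E iF inE.
by rewrite mesym1E; case: (boolP (i \in F)) => // /sub; rewrite inE.
Qed.

Lemma mcoeffMXE p k m :
  (p * 'X_[k])@_m = if (k <= m)%MM then p@_(m - k) else 0.
Proof.
case: ifP => [km|/negbT km]; first by rewrite -{1}(submK km) addmC mcoeffMX.
apply/eqP; rewrite -[_ == 0]negbK -mcoeff_msupp (perm_mem (msuppMX _ _)).
apply/mapP => -[m' _ mE]; case/negP: km; rewrite mE; exact: lem_addr.
Qed.

Lemma circuit_monomialE T : circuit_monomial K T = 'X_[mesym1 T].
Proof.
rewrite /circuit_monomial mprodXE; congr 'X_[_].
apply/mnmP=> i; rewrite mnmE mnm_sumE big_mkcond /=.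
rewrite (bigD1 i) //= mnmE eqxx /= big1 ?addn0 // => j ne_ji.
by case: (_ \in _); rewrite // mnmE (negbTE ne_ji).
Qed.

Section IdealGen.
Variable s : seq S.

Lemma ideal_gen0 : ideal_gen s 0.
Proof. by exists (fun=> 0); rewrite big1 // => i _; rewrite mul0r. Qed.

Lemma ideal_genD p q : ideal_gen s p -> ideal_gen s q -> ideal_gen s (p + q).
Proof.
move=> [a ->] [b ->]; exists (fun i => a i + b i).
by rewrite -big_split; apply: eq_bigr => i _; rewrite mulrDl.
Qed.

Lemma ideal_genM q p : p \in s -> ideal_gen s (q * p).
Proof.
move=> ps; have ip : (index p s < size s)%N by rewrite index_mem.
exists (fun i => if i == Ordinal ip then q else 0).
rewrite (bigD1 (Ordinal ip)) //= eqxx nth_index // big1 ?addr0 // => i /negPf ->.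
by rewrite mul0r.
Qed.

End IdealGen.

Definition divisible (C : {set {set 'I_n}}) m := [exists T in C, (mesym1 T <= m)%MM].

Lemma circuit_idealP C p :
  circuit_ideal K C p <-> forall m, p@_m != 0 -> divisible C m.
Proof.
split=> [[c ->] m|supp_p].
  rewrite raddf_sum /= => nz.
  have [i nzi] : exists i : 'I_(size [seq circuit_monomial K T | T <- enum C]),
      (c i * [seq circuit_monomial K T | T <- enum C]`_i)@_m != 0.
    apply/existsP; apply: contraNT nz; rewrite negb_exists => /forallP z.
    by rewrite big1 // => i _; apply/eqP; have := z i; rewrite negbK.
  move: nzi; have := mem_nth 0 (ltn_ord i).
  case/mapP => T; rewrite mem_enum => TC ->.
  rewrite circuit_monomialE mcoeffMXE; case: ifP => [Tm _|_]; last by rewrite eqxx.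
  by apply/existsP; exists T; rewrite TC.
rewrite (mpolyE p) big_seq; elim/big_rec: _ => [|m q mp IH]; first exact: ideal_gen0.
apply: ideal_genD IH; move: mp; rewrite mcoeff_msupp => /supp_p/existsP[T /andP[TC Tm]].
rewrite -(submK Tm) mpolyXD -circuit_monomialE scalerAl.
by apply: ideal_genM; apply: map_f; rewrite mem_enum.
Qed.

Lemma circuit_ideal_generated (C : {set {set 'I_n}}) d : {in C, forall T, #|T| = d} ->
  generated_in_degree d (circuit_ideal K C).
Proof.
move=> Cd; exists [seq circuit_monomial K T | T <- enum C] => // p.
case/mapP => T; rewrite mem_enum => /Cd Td ->.
by rewrite circuit_monomialE dhomogX /= mdeg_mesym1 Td.
Qed.

Lemma circuit_ideal_nonzero (C : {set {set 'I_n}}) : C != set0 ->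
  exists2 p, circuit_ideal K C p & p != 0.
Proof.
case/set0Pn => T TC; exists (circuit_monomial K T).
  rewrite -[circuit_monomial K T]mul1r.
  by apply: ideal_genM; apply: map_f; rewrite mem_enum.
rewrite circuit_monomialE; apply/eqP => /mpolyP/(_ (mesym1 T))/eqP.
by rewrite mcoeffX mcoeff0 eqxx oner_eq0.
Qed.

End Monomials.

(** * The Koszul resolution, one multidegree at a time *)

Section Koszul.
Variables (K : fieldType) (n : nat).
Local Notation S := {mpoly K[n]}.
Implicit Types (F G H T U : {set 'I_n}) (m b : 'X_{1..n}) (i j : nat).

Definition level i : {set {set 'I_n}} := [set F : {set 'I_n} | #|F| == i].
Local Notation rk i := #|level i|.

Definition face i (k : 'I_(rk i)) : {set 'I_n} := enum_val k.

Lemma card_face i (k : 'I_(rk i)) : #|face k| = i.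
Proof. by have := enum_valP k; rewrite inE => /eqP. Qed.

Lemma face_inj i : injective (@face i).
Proof. exact: enum_val_inj. Qed.

(** The sum has at most one term; this form avoids naming the point of [face k] outside [face l]. *)
Definition kdiff i : 'M[S]_(rk i.+1, rk i) := \matrix_(k, l)
  \sum_(x | (x \notin face l) && (x |: face l == face k)) sg K x (face l) *: 'X_x.

(* The entry of v indexed by F, and 0 if F does not have cardinality i. *)
Definition entry i (v : 'rV[S]_(rk i)) F : S := \sum_(k | face k == F) v 0 k.

Lemma entry_face i (v : 'rV[S]_(rk i)) k : entry v (face k) = v 0 k.
Proof. by rewrite /entry (big_pred1 k) // => l; rewrite (inj_eq (@face_inj i)). Qed.

Lemma faceP i F : #|F| = i -> exists k : 'I_(rk i), face k = F.
Proof.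
move=> Fi; have FL : F \in level i by rewrite inE Fi.
by exists (enum_rank_in FL F); rewrite /face enum_rankK_in.
Qed.

Lemma entry_card i (v : 'rV[S]_(rk i)) F : #|F| != i -> entry v F = 0.
Proof.
move=> Fi; rewrite /entry big1 // => k /eqP kF.
by case/eqP: Fi; rewrite -kF card_face.
Qed.

Lemma entry_mul i (w : 'rV[S]_(rk i.+1)) F :
  entry (w *m kdiff i) F =
  \sum_(x | x \notin F) sg K x F *: (entry w (x |: F) * 'X_x).
Proof.
have [Fi|Fi] := eqVneq #|F| i; last first.
  rewrite entry_card // big1 // => x xF.
  by rewrite entry_card ?mul0r ?scaler0 // cardsU1 xF.
have [l <-] := faceP Fi; rewrite entry_face mxE.
under eq_bigr do rewrite mxE mulr_sumr.
rewrite (exchange_big_dep (fun x => x \notin face l)) /=; last by move=> k x _ /andP[].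
apply: eq_bigr => x xF; rewrite /entry mulr_suml scaler_sumr.
apply: eq_big => [k|k _]; first by rewrite xF eq_sym.
by rewrite -scalerAr.
Qed.

(* Multidegree b part: the coefficient of x^(b - F) e_F. *)
Definition strand i (v : 'rV[S]_(rk i)) b F : K :=
  if (mesym1 F <= b)%MM then (entry v F)@_(b - mesym1 F) else 0.

(** Multiplying by the variable of x compensates for removing x from the index set, so [b] is
    preserved and the Koszul differential becomes the simplicial boundary. *)
Lemma strand_mul i (w : 'rV[S]_(rk i.+1)) b F :
  strand (w *m kdiff i) b F = bd (strand w b) F.
Proof.
rewrite /strand /bd; case: ifP => [Fb|Fb]; last first.
  rewrite big1 // => x xF; rewrite !le_mesym1 in Fb *.
  by rewrite subUset Fb andbF mulr0.
rewrite entry_mul raddf_sum /=; apply: eq_bigr => x xF.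
rewrite mcoeffZ mcoeffMXE; congr (_ * _).
have Ux : mesym1 (x |: F) = (mesym1 F + U_(x))%MM.
  apply/mnmP => y; rewrite mnmDE !mesym1E mnm1E in_setU1 eq_sym.
  by case: eqP => [<-|_]; rewrite ?(negPf xF) ?addn0.
rewrite Ux submDA; congr (if _ then _ else _).
apply/mnm_lepP/mnm_lepP => le y; have := le y; have := mnm_lepP Fb y;
  rewrite mnmDE mnmBE; lia.
Qed.

Lemma strand_face i (v : 'rV[S]_(rk i)) m k :
  strand v (m + mesym1 (face k)) (face k) = (v 0 k)@_m.
Proof. by rewrite /strand lem_addl entry_face addmK. Qed.

Lemma eq_strand i (v w : 'rV[S]_(rk i)) :
  (forall b F, strand v b F = strand w b F) -> v = w.
Proof.
by move=> e; apply/rowP => k; apply/mpolyP => m; rewrite -!strand_face e.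
Qed.

Lemma strand_neq0 i (v : 'rV[S]_(rk i)) b F : strand v b F != 0 ->
  [/\ #|F| = i, (mesym1 F <= b)%MM &
    exists2 k, face k = F & (v 0 k)@_(b - mesym1 F) != 0].
Proof.
rewrite /strand; case: ifP => [Fb|_]; last by rewrite eqxx.
have [Fi|Fi] := eqVneq #|F| i; last by rewrite entry_card // mcoeff0 eqxx.
have [k kF] := faceP Fi => nz; split=> //; exists k => //.
by rewrite -entry_face kF.
Qed.

Lemma strand0 i b F : strand (0 : 'rV[S]_(rk i)) b F = 0.
Proof.
by apply/eqP; apply: contraT => /strand_neq0[_ _ [k _]]; rewrite mxE mcoeff0 eqxx.
Qed.

Lemma strand_bounded i (v : 'rV[S]_(rk i)) :
  exists N, forall b F, strand v b F != 0 -> (mdeg b < N)%N.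
Proof.
exists (\sum_k msize (v 0%R k) + i)%N => b F /strand_neq0[Fi Fb [k _ nz]].
rewrite -(submK Fb) mdegD mdeg_mesym1 Fi ltn_add2r.
rewrite -mcoeff_msupp in nz; apply: leq_trans (msize_mdeg_lt nz) _.
by rewrite (bigD1 k) //= leq_addr.
Qed.

(** The common degree bound [N] is what makes the reassembled entries polynomials. *)
Lemma strand_onto i N (c : 'X_{1..n} -> {set 'I_n} -> K) :
  (forall b G, c b G != 0 ->
    [/\ #|G| = i, (mesym1 G <= b)%MM & (mdeg b < N)%N]) ->
  exists w : 'rV[S]_(rk i), forall b G, strand w b G = c b G.
Proof.
move=> cP; pose f G m := c (m + mesym1 G)%MM G.
exists (\row_k \sum_(m : 'X_{1..n < N}) f (face k) m *: 'X_[m]) => b G.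
rewrite /strand; have [Gi|Gi] := eqVneq #|G| i; last first.
  rewrite entry_card // mcoeff0 if_same.
  by apply/esym/eqP; apply: contraNT Gi => /cP[->].
have [k kG] := faceP Gi; case: ifP => [Gb|Gb]; last first.
  by apply/esym/eqP; apply: contraFT Gb => /cP[].
rewrite -kG entry_face mxE kG; have [lt_N|ge_N] := ltnP (mdeg (b - mesym1 G)%MM) N.
  by rewrite mcoeff_mpoly // /f submK.
rewrite [RHS](_ : _ = 0).
  rewrite raddf_sum big1 // => m _; rewrite /= mcoeffZ mcoeffX.
  case: eqP => [mE|]; last by rewrite mulr0.
  by have := bmdeg m; rewrite mE ltnNge ge_N.
apply/eqP; apply: contraTT ge_N => /cP[_ _ ltb]; rewrite -ltnNge.
by apply: leq_ltn_trans ltb; exact: mdegB.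
Qed.

(** Reduces bounding [v] to one multidegree at a time. Taking [c] to be 0 where the strand of [v]
    vanishes makes the degree bound of [v] valid for [w] too. *)
Lemma strand_lift i (v : 'rV[S]_(rk i)) (Q : 'X_{1..n} -> {set 'I_n} -> Prop) :
  (forall b, (exists F, strand v b F != 0) -> exists2 c : {set 'I_n} -> K,
    (forall F, bd c F = strand v b F) &
    forall G, c G != 0 -> [/\ #|G| = i.+1, (mesym1 G <= b)%MM & Q b G]) ->
  exists2 w : 'rV[S]_(rk i.+1), v = w *m kdiff i &
    forall b G, strand w b G != 0 -> Q b G.
Proof.
move=> lift; have [N ltN] := strand_bounded v.
have ex b : exists c : {set 'I_n} -> K, (forall F, bd c F = strand v b F) /\
    forall G, c G != 0 ->
      [/\ #|G| = i.+1, (mesym1 G <= b)%MM & (mdeg b < N)%N] /\ Q b G.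
  case: (boolp.pselect (exists F, strand v b F != 0)) => [nz|z].
    have [c dc cP] := lift b nz; exists c; split=> // G /cP[Gi Gb QbG].
    by have [F /ltN ltb] := nz.
  exists (fun=> 0); split=> [F|G]; last by rewrite eqxx.
  rewrite /bd big1 => [|x _]; last by rewrite mulr0.
  by apply/esym/eqP; apply: boolp.contrapT => /negP nz; apply: z; exists F.
have [c cP] := boolp.choice ex.
have [b G|w wc] := @strand_onto i.+1 N c; first by case/((cP b).2 G).
exists w => [|b G]; last by rewrite wc => /((cP b).2 G)[].
apply: eq_strand => b F; rewrite strand_mul -(cP b).1.
by apply: eq_bigr => x _; rewrite wc.
Qed.

Lemma cone_lift i (v : 'rV[S]_(rk i)) b x : (0 < b x)%N ->
  (forall F, bd (strand v b) F = 0) ->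
  let c := cone x (strand v b) in
  (forall F, bd c F = strand v b F) /\
  forall G, c G != 0 -> [/\ #|G| = i.+1, (mesym1 G <= b)%MM,
    x \in G & strand v b (G :\ x) != 0].
Proof.
move=> bx dv; split; first exact: bd_cone_cycle.
move=> G; rewrite /cone; case: ifP => [xG|_]; last by rewrite eqxx.
rewrite mulf_eq0 negb_or => /andP[_ nz]; have [Gi Gb _] := strand_neq0 nz.
split=> //; first by rewrite (cardsD1 x) xG Gi.
by move: Gb; rewrite !le_mesym1 -{2}(setD1K xG) subUset sub1set inE bx.
Qed.

(** For nonzero [b] the strand lives on the nonempty simplex of the support of [b], where coning
    from any vertex bounds every cycle. *)
Lemma kdiff_exact i (v : 'rV[S]_(rk i)) :
  (forall b F, bd (strand v b) F = 0) -> (forall F, strand v 0%MM F = 0) ->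
  exists w, v = w *m kdiff i.
Proof.
move=> dv v0; have [|w vw _] := @strand_lift i v (fun _ _ => True); last by exists w.
move=> b [F nz]; have [x bx] : exists x, (0 < b x)%N.
  apply/existsP; apply: contraNT nz; rewrite negb_exists => /forallP b0.
  rewrite (_ : b = 0%MM) ?v0 //; apply/mnmP => x; have := b0 x.
  by rewrite mnm0E -eqn0Ngt => /eqP.
have [dc cP] := cone_lift bx (dv b).
by exists (cone x (strand v b)) => // G /cP[].
Qed.

Lemma kdiff_mul0 i (v : 'rV[S]_(rk i.+1)) :
  v *m kdiff i = 0 <-> forall b F, bd (strand v b) F = 0.
Proof.
split=> [vd b F|dv]; first by rewrite -strand_mul vd strand0.
by apply: eq_strand => b F; rewrite strand_mul dv strand0.
Qed.

Definition kshift i (_ : 'I_(rk i)) : nat := i.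
Definition kaug : 'cV[K]_(rk 0) := const_mx 1.

Lemma kdiff_graded i k :
  homog_vec (@kshift i) (@kshift i.+1 k) (row k (kdiff i)).
Proof.
move=> l m; rewrite !mxE raddf_sum /= => nz; rewrite /kshift.
apply/eqP; apply: contraNT nz => mi; rewrite big1 // => x _.
rewrite mcoeffZ mcoeffX; case: eqP => [xm|]; last by rewrite mulr0.
by rewrite -xm mdeg1 add1n eqxx in mi.
Qed.

Lemma kaugE (v : 'rV[S]_(rk 0)) :
  map_mx (mcoeff 0%MM) v *m kaug = (strand v 0%MM set0)%:M.
Proof.
apply/rowP => k; rewrite ord1 !mxE eqxx mulr1n /strand le_mesym1 sub0set.
rewrite mesym1_set0 subm0 /entry raddf_sum /=; apply: eq_big => [l|l _].
  by rewrite -cards_eq0 card_face.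
by rewrite !mxE mulr1.
Qed.

Lemma strand_at0 i (v : 'rV[S]_(rk i)) F : strand v 0%MM F != 0 -> F = set0.
Proof.
case/strand_neq0 => _ + _; rewrite le_mesym1 => sub.
apply/eqP; rewrite -subset0; apply: subset_trans sub _.
by apply/subsetP => x; rewrite !inE mnm0E.
Qed.

Lemma kaug_surj : exists v : 'rV[S]_(rk 0), map_mx (mcoeff 0%MM) v *m kaug = 1%:M.
Proof.
exists (const_mx 1); rewrite kaugE; congr (_%:M).
have [k k0] := faceP (cards0 'I_n : #|set0 : {set 'I_n}| = 0%N).
by have := strand_face (const_mx 1 : 'rV[S]_(rk 0)) 0%MM k;
  rewrite k0 mesym1_set0 addm0 mxE mcoeff1 eqxx.
Qed.

Lemma kexact0 (v : 'rV[S]_(rk 0)) :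
  map_mx (mcoeff 0%MM) v *m kaug = 0 <-> exists w, v = w *m kdiff 0.
Proof.
rewrite kaugE; split=> [/(congr1 (fun A : 'M_1 => A 0 0))|[w ->]].
  rewrite !mxE eqxx mulr1n => v0; apply: kdiff_exact => [b F|F].
    rewrite /bd big1 // => x xF.
    have [->|/strand_neq0[]] := eqVneq (strand v b (x |: F)) 0; first by rewrite mulr0.
    by rewrite cardsU1 xF.
  have [//|nz] := eqVneq (strand v 0%MM F) 0.
  by move: (nz); rewrite (strand_at0 nz) v0 eqxx.
rewrite strand_mul /bd big1 ?scalar_mx0 ?raddf0 // => x _.
have [->|/strand_at0/setP/(_ x)] := eqVneq (strand w 0%MM (x |: set0)) 0.
  by rewrite mulr0.
by rewrite !inE eqxx.
Qed.

Lemma kexactS i (v : 'rV[S]_(rk i.+1)) :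
  v *m kdiff i = 0 <-> exists w, v = w *m kdiff i.+1.
Proof.
split=> [/kdiff_mul0 dv|[w ->]].
  apply: kdiff_exact => // F.
  have [//|nz] := eqVneq (strand v 0%MM F) 0.
  by have [+ _ _] := strand_neq0 nz; rewrite (strand_at0 nz) cards0.
apply/kdiff_mul0 => b F; rewrite -[RHS](bd_bd (strand w b) F).
by apply: eq_bigr => x _; rewrite strand_mul.
Qed.

Definition koszul : residue_resolution K n :=
  @ResidueResolution K n (fun i => rk i) kshift kdiff kaug kdiff_graded
    (fun _ _ => erefl) kaug_surj kexact0 kexactS.

Lemma homog_strand i j (v : 'rV[S]_(rk i)) :
  homog_vec (@kshift i) j v <-> forall b F, strand v b F != 0 -> mdeg b = j.
Proof.
split=> [vj b F /strand_neq0[Fi Fb [k kF /vj]]|vj k m nz].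
  by rewrite -{2}(submK Fb) mdegD mdeg_mesym1 Fi.
rewrite -strand_face in nz; have := vj _ _ nz.
by rewrite mdegD mdeg_mesym1 card_face.
Qed.

Lemma circuit_ideal_strand (C : {set {set 'I_n}}) i (v : 'rV[S]_(rk i)) :
  (forall k, circuit_ideal K C (v 0 k)) <->
  forall b F, strand v b F != 0 -> divisible C (b - mesym1 F)%MM.
Proof.
split=> [vC b F /strand_neq0[_ _ [k _]]|vC k].
  by move/circuit_idealP: (vC k) => /[apply].
by apply/circuit_idealP => m; rewrite -strand_face => /vC; rewrite addmK.
Qed.

Lemma divisible_mesym1 (C : {set {set 'I_n}}) m :
  divisible C m = [exists T in C, T \subset [set x | (0 < m x)%N]].
Proof. by apply: eq_existsb => T; rewrite le_mesym1. Qed.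

Lemma circuit_ideal_betti_eq0 (C : {set {set 'I_n}}) d i j :
  {in C, forall F, #|F| = d} ->
  (forall U, (d < #|U|)%N -> [exists T in clutter_compl d C, T \subset U]) ->
  (forall z : {set 'I_n} -> K, (forall F, z F != 0 -> F \in C) ->
     (forall G, bd z G = 0) -> forall F, z F = 0) ->
  (i + d < j)%N ->
  graded_betti (circuit_ideal K (clutter_compl d C)) i j 0.
Proof.
(* Dimension 0 is witnessed by the empty basis, so each cycle has to be shown to be a boundary. *)
move=> Cd large inj ij; exists koszul; exists (fun=> 0); split; [by case|by move=> ? _ []|].
move=> v cyc; exists (fun=> 0); rewrite big_ord0 subr0.
have [vj vC] : tor_chain (P := koszul) (circuit_ideal K (clutter_compl d C)) j v.
  by case: i v cyc {ij} => [|i] v //= [].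
have dv b F : bd (strand v b) F = 0.
  case: i v cyc {ij vj vC} => [|i] v /= cyc; last by have [_ /kdiff_mul0] := cyc.
  rewrite /bd big1 // => x xF.
  have [->|/strand_neq0[]] := eqVneq (strand v b (x |: F)) 0; first by rewrite mulr0.
  by rewrite cardsU1 xF.
move/homog_strand: vj => vj; move/circuit_ideal_strand: vC => vC.
pose Q b G := mdeg b = j /\ divisible (clutter_compl d C) (b - mesym1 G)%MM.
have [|w -> wQ] := @strand_lift i v Q; last first.
  exists w => //; split; first by apply/homog_strand => b F /wQ[].
  by apply/circuit_ideal_strand => b F /wQ[].
move=> b [F nzF]; have bj := vj _ _ nzF.
(* If [b] is not squarefree, cone from an [x] of exponent at least 2: lowering this exponent by one
   does not change the support, so the coefficients remain in the ideal. *)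
have [x b2|b1] := pickP (fun x => (1 < b x)%N).
  have [dc cP] := cone_lift (ltnW b2) (dv b).
  exists (cone x (strand v b)) => // G /cP[Gi Gb xG /vC dvd]; split=> //; split=> //.
  move: dvd; rewrite !divisible_mesym1 => /existsP[T /andP[TC sub]].
  apply/existsP; exists T; rewrite TC; apply/subsetP => y /(subsetP sub).
  rewrite !inE !mnmBE !mesym1E !inE; case: eqP => [->|//]; rewrite xG; lia.
pose W := [set x | (0 < b x)%N].
have bW : b = mesym1 W.
  apply/mnmP => x; rewrite mesym1E inE; have := b1 x; rewrite /=; lia.
have subW G : (mesym1 G <= b)%MM = (G \subset W) by rewrite le_mesym1.
have [||||c dc cP] := @clutter_exact K n C d i
  [pred U : {set 'I_n} | [exists T in clutter_compl d C, T \subset U]]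
  W (strand v b) inj large.
- move=> U Ud UC; apply/existsP; exists U; by rewrite subxx inE Ud eqxx UC.
- by rewrite -mdeg_mesym1 -bW bj.
- by move=> G /strand_neq0[Gi]; rewrite subW.
- exact: dv.
exists c => // G /cP[Gi GW good]; rewrite subW; split=> //; split=> //.
rewrite divisible_mesym1 (_ : [set x | _] = W :\: G) //.
apply/setP => y; rewrite !inE mnmBE mesym1E bW mesym1E inE.
by case: (y \in G); case: (0 < b y)%N.
Qed.

End Koszul.
End Koszul.

(** * The facet clutter: non-chordality and linear resolution *)

Lemma mem_facets n d (D : {set {set 'I_n}}) (F1 : {set 'I_n}) : pure D ->
  (forall F, F \in D -> #|F| <= d) -> F1 \in D -> #|F1| = d ->
  forall F, F \in facets D <-> F \in D /\ #|F| = d.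
Proof.
move=> pureD leD F1D F1d.
have top F : F \in D -> #|F| = d -> F \in facets D.
  move=> FD Fd; rewrite inE FD; apply/'forall_implyP => G GD; apply/implyP => FG.
  by rewrite eqEcard FG Fd leD.
move=> F; split=> [FD|[]]; last exact: top.
have := pureD _ _ FD (top _ F1D F1d); rewrite /face_dim => /GRing.addIr[->].
by move: FD; rewrite inE => /andP[].
Qed.

Theorem proposition4p4 (R : realType) (n d : nat) (D : {set {set 'I_n}})
    (hD : simplicial_complex_on D)
    (hpure : pure D)
    (hdim : complex_dim D = (d%:Z - 1)%R)
    (hcontractible : contractible_complex R D)
    (hfree : ~ exists F : {set 'I_n}, free_face D F)
    (hclique : complex_dim (clique_complex d (facets D)) = (d%:Z - 1)%R) :
  ~ chordal d (facets D) /\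
  (forall K : fieldType,
     linear_resolution d (circuit_ideal K (clutter_compl d (facets D)))).
Proof.
have [vD subD] := hD.
have maxD : \max_(F in D) #|F| = d by have /GRing.addIr[] := hdim.
have maxC : \max_(F in clique_complex d (facets D)) #|F| = d.
  by have /GRing.addIr[] := hclique.
have leD F : F \in D -> #|F| <= d by move=> FD; rewrite -maxD; exact: leq_bigmax_cond.
have leC F : F \in clique_complex d (facets D) -> #|F| <= d.
  by move=> FC; rewrite -[X in _ <= X]maxC; exact: leq_bigmax_cond.
have n0 : 0 < n by have [p /Homotopy.realization_dim_gt0] := hcontractible.
have [F1 F1D F1d] : exists2 F, F \in D & #|F| = d.
  have [|F FD maxF] := @eq_bigmax_cond _ (mem D) (fun F : {set 'I_n} => #|F|).
    by apply/card_gt0P; exists [set Ordinal n0]; exact: vD.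
  by exists F => //; rewrite -maxF.
have facetP := mem_facets hpure leD F1D F1d.
have F1f : F1 \in facets D by apply/facetP.
have facet_card F : F \in facets D -> #|F| = d by case/facetP.
split.
  move=> ch; inversion ch as [C0|C e [ed [F FC eF] nb] _ CE].
    by move: F1f; rewrite -C0 inE.
  (* Every facet through [e] is contained in the closed neighbourhood, a clique with at most d
     points, and so equals it. *)
  have eN G : G \in facets D -> e \subset G -> G = closed_nbhd (facets D) e.
    move=> GC eG; apply/eqP; rewrite eqEcard (facet_card _ GC) leC // andbT.
    apply/subsetP => x xG; rewrite in_setU in_set; have [//|xe] := boolP (x \in e).
    suff -> : x |: e = G by [].
    apply/eqP; rewrite eqEcard subUset sub1set xG eG.
    by rewrite cardsU1 xe (facet_card _ GC) add1n ed leqnn.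
  apply: hfree; exists e; split; first by apply: subD eF; case/facetP: FC.
  exists F; split=> [|G [GC /proper_sub eG]]; last by rewrite (eN F) // (eN G).
  by split=> //; rewrite properEcard eF (facet_card _ FC) ed leqnn.
move=> K; set C := clutter_compl d (facets D).
have CE T : T \in C = (#|T| == d) && (T \notin facets D) by rewrite inE.
(* A set containing no circuit of the complementary clutter is a clique, to which the dimension
   bound applies. *)
have large (U : {set 'I_n}) : (forall T, T \in C -> ~~ (T \subset U)) -> #|U| <= d.
  move=> noT; apply: leC; rewrite inE; apply/orP; right.
  apply/forallP => T; apply/implyP => /andP[TU Td].
  by apply: contraLR TU => Tf; apply: noT; rewrite CE Td.
split.
(* If every d-set were a facet, the whole vertex set would be a clique, hence have at most d points
   and be the only facet; the empty face would then be free. *)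
- apply: Koszul.circuit_ideal_nonzero; apply/eqP => C0.
  have dn : #|[set: 'I_n]| <= d by apply: large => T; rewrite C0 inE.
  have facetT G : G \in facets D -> G = setT.
    by move=> Gf; apply/eqP; rewrite eqEcard subsetT (facet_card _ Gf).
  apply: hfree; exists set0; split; first by apply: subD F1D (sub0set _).
  exists F1; split=> [|G [/facetT -> _]]; last exact: facetT.
  by split=> //; rewrite (facetT _ F1f) properEcard sub0set cards0 cardsT card_ord.
- by apply: Koszul.circuit_ideal_generated => T; rewrite CE => /andP[/eqP].
- move=> i j; apply: Koszul.circuit_ideal_betti_eq0 => // [U dU|z zf dz].
    apply: contraTT dU; rewrite negb_exists -leqNgt => /forallP noT.
    by apply: large => T TC; have := noT T; rewrite TC.
  apply: (Homotopy.cycles_trivial subD leD hcontractible) => // F zF.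
  exact/facetP/zf.
Qed.
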